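(* Let $G=G_1*\cdots*G_r$, $\mu$, $\pi$, $\rho$, the Galton–Watson tree $\mathbb{T}$, the branching random walk $(X_v)_{v\in\mathbb{T}}$ on $G$, the word length $|\cdot|$, and the rate function $I$ be as described in the context, and let all the assumptions listed there hold. Set $$v_{\min}:=\inf\{x\ge 0:\ I(x)\le \log\rho\}.$$ Then $$\lim_{n\to\infty}\frac{\min_{|v|=n}|X_v|}{n}=v_{\min}\qquad\text{almost surely}.$$
   Context: **Group.** Let $r\ge 2$ and let $G_1,\dots,G_r$ be disjoint nontrivial finite groups (possibly isomorphic to each other) with identities $e_k$; $G_k^\times:=G_k\setminus\{e_k\}$. Let $G=G_1*\cdots*G_r$ be their free product, i.e. the set of finite words over $\bigcup_k G_k^\times$ with no two consecutive letters in the same $G_k$, together with the empty word $e$, with the group operation concatenation followed by reduction; each $G_k$ is regarded as a subgroup of $G$. For each $k$ let $S_k\subseteq G_k^\times$ be a symmetric generating set of $G_k$, and $S=\bigcup_k S_k$. For $x\in G$, $|x|$ is the word length of $x$ with respect to $S$ (graph distance from $e$ to $x$ in the Cayley graph $\mathrm{Cay}(G,S)$). **Random walk.** Let $\mu=\sum_{i=1}^r\alpha_i\mu_i$, where $\alpha_i\ge 0$, $\sum_i\alpha_i=1$ and $\mu_i$ is a probability measure on $G_i$. Let $(Y_n)_{n\in\mathbb{N}}$ be the random walk on $G$ started at $Y_0=e$ with transition probabilities $p(x,y)=\mu(x^{-1}y)$. **Assumption on the walk.** $\alpha_k>0$ for every $k\in\{1,\dots,r\}$; each $\mu_k$ is irreducible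 on $G_k$; and if $r=2$, at least one of $G_1,G_2$ has cardinality greater than $2$. **Rate function.** For $t\in\mathbb{R}$ let $\Lambda(t)=\lim_{n\to\infty}\frac1n\log\mathbb{E}[e^{t|Y_n|}]$ (the limit exists), and for $x\ge 0$ let $I(x)=\sup_{t\in\mathbb{R}}\{xt-\Lambda(t)\}\in[0,\infty]$; this is the large deviation rate function of $(|Y_n|/n)_n$. **Branching random walk.** Let $\pi$ be a probability distribution on $\mathbb{N}\cup\{0\}$ with mean $\rho=\sum_k k\pi(k)$, satisfying $1<\rho<\infty$ and $\pi(0)=0$. Let $\mathbb{T}$ be the Galton–Watson tree with offspring distribution $\pi$ (Ulam–Harris labelling, root $\emptyset$); $|v|$ denotes the generation of $v\in\mathbb{T}$ and, for $k\le|v|$, $v_k$ denotes the ancestor of $v$ in generation $k$. Given $\mathbb{T}$, let $(\zeta_v)_{v\in\mathbb{T}}$ be i.i.d. with law $\mu$, and set $X_\emptyset=e$ and $X_v=\zeta_{v_1}\zeta_{v_2}\cdots\zeta_{v}$ for $v\in\mathbb{T}$. The minimum over $|v|=n$ is over vertices $v\in\mathbb{T}$ of generation $n$. *)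

(* Defs.v *)
From HB Require Import structures.
From mathcomp Require Import all_boot all_order all_fingroup all_algebra.
From mathcomp Require Import all_classical all_reals all_analysis.

Set Implicit Arguments.
Unset Strict Implicit.
Unset Printing Implicit Defensive.

Import Order.TTheory GRing.Theory Num.Theory.
Import numFieldNormedType.Exports.

Local Open Scope classical_set_scope.
Local Open Scope ring_scope.

Section FreeProduct.
Context (r : nat) (gT : 'I_r -> finGroupType).
Local Open Scope group_scope.

(* Tagging makes the factors disjoint, even when they are isomorphic. *)
Definition letter := {k : 'I_r & gT k}.

Definition is_reduced (w : seq letter) : bool :=
  all (fun a : letter => tagged a != 1) w && sorted (fun a b : letter => tag a != tag b) w.

(* Left multiplication of a reduced word by g, viewed as an element of the
   factor k, followed by reduction. *)
Definition word_cons (k : 'I_r) (g : gT k) (w : seq letter) : seq letter :=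
  if g == 1 then w else
  if w is b :: w' then
    if tag b == k then
      let h := g * tagged_as (Tagged gT g) b in
      if h == 1 then w' else Tagged gT h :: w'
    else Tagged gT g :: w
  else [:: Tagged gT g].

Definition word_mul (u v : seq letter) : seq letter :=
  foldr (fun (a : letter) w => word_cons (tagged a) w) v u.

Definition word_inv (w : seq letter) : seq letter :=
  rev [seq Tagged gT (tagged a)^-1 | a : letter <- w].

Lemma reduced_behead a w : is_reduced (a :: w) -> is_reduced w.
Proof.
move=> /andP[/= /andP[_ h1] h2]; rewrite /is_reduced h1 /=.
exact: path_sorted h2.
Qed.

Lemma word_cons_reduced k (g : gT k) w :
  is_reduced w -> is_reduced (word_cons g w).
Proof.
rewrite /word_cons; case: eqVneq => // g1.
case: w => [|[l h] w] wr; first by rewrite /is_reduced /= g1.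
case: (eqVneq (tag (Tagged gT h)) k) => [e|ne] /=; last first.
  move: wr; rewrite /is_reduced /= g1 /= => /andP[-> ->].
  by rewrite andbT /= eq_sym ne.
case: eqVneq => h1; first exact: reduced_behead wr.
move: wr; rewrite /is_reduced /= h1 /= => /andP[/andP[_ ->]] /=.
by rewrite /= in e; subst l; case: w.
Qed.

Lemma word_cons1 k w : word_cons (1 : gT k) w = w.
Proof. by rewrite /word_cons eqxx. Qed.

Lemma word_consM k (g h : gT k) w : is_reduced w ->
  word_cons g (word_cons h w) = word_cons (g * h) w.
Proof.
move=> wr; have [->|g1] := eqVneq g 1; first by rewrite word_cons1 mul1g.
have [->|h1] := eqVneq h 1; first by rewrite word_cons1 mulg1.
rewrite {2 3}/word_cons (negPf h1).
case: w wr => [|[l c] w] wr.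
  rewrite /word_cons (negPf g1) /= eqxx tagged_asE.
  by case: eqP.
case: (eqVneq (tag (Tagged gT c)) k) => [/= e|/= ne].
  subst l; rewrite !tagged_asE.
  have c1 : c != 1 by case/andP: wr => /= /andP[].
  have wr' := reduced_behead wr.
  case: (eqVneq (h * c) 1) => hc.
    have ch : c = h^-1 by apply/eqP; rewrite -(mulKg h c) hc mulg1.
    have wk : forall x : gT k, word_cons x w
        = if x == 1 then w else Tagged gT x :: w.
      move=> x; rewrite /word_cons; case: eqVneq => // _.
      case: w wr {wr'} => [|[m d] w] //= /andP[_] /= /andP[/negPf + _].
      by rewrite eq_sym => ->.
    rewrite wk (negPf g1) ch mulgK (negPf g1).
    case: eqVneq => // gh.
    by have -> : h^-1 = g by rewrite -(mulgK h g) gh mul1g.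
  rewrite /word_cons (negPf g1) /= eqxx tagged_asE mulgA.
  case: (eqVneq (g * h) 1) => // gh; rewrite gh mul1g (negPf c1).
  by [].
rewrite {1}/word_cons (negPf g1) /= eqxx tagged_asE.
by case: eqP.
Qed.

Lemma word_mul_reduced u v : is_reduced v -> is_reduced (word_mul u v).
Proof. by move=> vr; elim: u => //= a u; apply: word_cons_reduced. Qed.

Lemma word_mul_cons k (g : gT k) u v : is_reduced u -> is_reduced v ->
  word_mul (word_cons g u) v = word_cons g (word_mul u v).
Proof.
move=> ur vr; rewrite {1}/word_cons.
case: eqVneq => [->|g1]; first by rewrite word_cons1.
case: u ur => [|[l h] u] //= ur.
case: eqVneq => // e; subst l; rewrite tagged_asE.
rewrite word_consM; last exact: word_mul_reduced.
by case: eqVneq => [->|_] //=; rewrite word_cons1.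
Qed.

Lemma word_mulA u v w : is_reduced v -> is_reduced w ->
  word_mul u (word_mul v w) = word_mul (word_mul u v) w.
Proof.
move=> vr wr; elim: u => //= a u ->.
by rewrite word_mul_cons //; apply: word_mul_reduced.
Qed.

Lemma word_mul1 u : is_reduced u -> word_mul u [::] = u.
Proof.
elim: u => //= -[k g] u ih ur; rewrite ih; last exact: reduced_behead ur.
rewrite /word_cons; have g1 : g != 1 by case/andP: ur => /= /andP[].
rewrite (negPf g1); case: u ur {ih} => [|[l h] u] //= ur.
case/andP: ur => _ /= /andP[/negPf + _].
by rewrite eq_sym => ->.
Qed.

Lemma word_invK : involutive word_inv.
Proof.
move=> w; rewrite /word_inv map_rev revK -map_comp -[RHS]map_id.
by apply: eq_map => -[k g] /=; rewrite invgK.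
Qed.

Lemma word_inv_reduced w : is_reduced w -> is_reduced (word_inv w).
Proof.
move=> /andP[h1 h2]; apply/andP; split.
  rewrite /word_inv all_rev all_map; apply: sub_all h1 => -[k g] /=.
  by rewrite invg_eq1.
rewrite /word_inv rev_sorted sorted_map.
by apply: sub_sorted h2 => -[k g] [l h] /=; rewrite eq_sym.
Qed.

Lemma word_mulV w : is_reduced w -> word_mul (word_inv w) w = [::].
Proof.
elim: w => //= -[k g] w ih wr; rewrite /word_inv /= rev_cons -cats1.
rewrite /word_mul foldr_cat /=.
have g1 : g != 1 by case/andP: wr => /= /andP[].
rewrite {2}/word_cons invg_eq1 (negPf g1) /= eqxx tagged_asE mulVg eqxx.
exact: ih (reduced_behead wr).
Qed.

Definition freeprod := {w : seq letter | is_reduced w}.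

HB.instance Definition _ := Choice.on freeprod.

Definition fp1 : freeprod := Sub [::] isT.
Definition fpM (x y : freeprod) : freeprod :=
  Sub (word_mul (val x) (val y)) (word_mul_reduced (val x) (valP y)).
Definition fpV (x : freeprod) : freeprod :=
  Sub (word_inv (val x)) (word_inv_reduced (valP x)).

Lemma fpMA : associative fpM.
Proof.
by move=> x y z; apply: val_inj; rewrite /= word_mulA ?(valP y) ?(valP z).
Qed.
Lemma fp1M : left_id fp1 fpM.
Proof. by move=> x; apply: val_inj. Qed.
Lemma fpM1 : right_id fp1 fpM.
Proof. by move=> x; apply: val_inj; rewrite /= word_mul1 ?(valP x). Qed.
Lemma fpVM : left_inverse fp1 fpV fpM.
Proof. by move=> x; apply: val_inj; rewrite /= word_mulV ?(valP x). Qed.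
Lemma fpMV : right_inverse fp1 fpV fpM.
Proof.
move=> x; apply: val_inj => /=.
by rewrite -{1}[val x]word_invK word_mulV ?word_inv_reduced ?(valP x).
Qed.

HB.instance Definition _ := isGroup.Build freeprod fpMA fp1M fpM1 fpVM fpMV.

Lemma letter_reduced k (g : gT k) :
  is_reduced (if g == 1 then [::] else [:: Tagged gT g]).
Proof. by rewrite /is_reduced; case: ifPn => //= ->. Qed.

(* The canonical embedding of the factor k. *)
Definition fp_in (k : 'I_r) (g : gT k) : freeprod :=
  Sub (if g == 1 then [::] else [:: Tagged gT g]) (letter_reduced g).

Lemma fp_inM k : {morph @fp_in k : g h / g * h}.
Proof.
move=> g h; apply: val_inj => /=.
have [->|g1] := eqVneq g 1; first by rewrite mul1g.
have [->|h1] := eqVneq h 1.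
  by rewrite mulg1 (negPf g1) /word_mul /= /word_cons (negPf g1).
by rewrite /word_mul /= /word_cons (negPf g1) /= eqxx tagged_asE.
Qed.

Lemma fp_in_inj k : injective (@fp_in k).
Proof.
move=> g h /(congr1 val) /=.
case: eqVneq => [->|_]; case: eqVneq => [->|_] //.
by case=> /eqP; rewrite -tag_eqE /tag_eq /= eqxx tagged_asE => /eqP.
Qed.

End FreeProduct.

Section WordLength.
Context (r : nat) (gT : 'I_r -> finGroupType) (S : forall k, {set gT k}).

Definition symmetric_generating (k : 'I_r) : Prop :=
  [/\ (1 \notin S k)%g, forall g, g \in S k -> (g^-1 \in S k)%g
    & <<S k>>%g = [set: gT k]%SET].

Definition is_generator (x : freeprod gT) : bool :=
  [exists k, exists g in S k, x == fp_in g].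

Definition cayley_edge (x y : freeprod gT) : bool := is_generator (x^-1 * y)%g.

(* The least element of a nonempty set of natural numbers, 0 by convention for
   the empty set. *)
Definition nat_min (A : set nat) : nat :=
  xget 0%N [set n | A n /\ forall m, A m -> (n <= m)%N].

Lemma nat_minP (A : set nat) : A !=set0 ->
  A (nat_min A) /\ forall m, A m -> (nat_min A <= m)%N.
Proof.
move=> [n0 An0]; rewrite /nat_min; case: xgetP => [n -> //|none].
have ex : exists n, `[< A n >] by exists n0; apply/asboolP.
exfalso; apply: (none (ex_minn ex)); case: ex_minnP => n /asboolP An nmin.
by split=> // m Am; apply/nmin/asboolP.
Qed.

Definition cayley_dist (x y : freeprod gT) : nat :=
  nat_min [set n | exists s : seq (freeprod gT),
    [/\ path cayley_edge x s, last x s = y & size s = n]].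

Definition wlen (x : freeprod gT) : nat := cayley_dist 1%g x.

End WordLength.

Section StepDistribution.
Context (R : realType).

Definition is_fin_prob (T : finType) (m : T -> R) : Prop :=
  (forall x, 0 <= m x) /\ \sum_x m x = 1.

(* n-step transition probabilities of the random walk on gT with step law m. *)
Fixpoint nstep (gT : finGroupType) (m : gT -> R) (n : nat) (x y : gT) : R :=
  if n is n'.+1 then \sum_(z : gT) m (x^-1 * z)%g * nstep m n' z y
  else (x == y)%:R.

Definition irreducible_step (gT : finGroupType) (m : gT -> R) : Prop :=
  forall x y : gT, exists n : nat, 0 < nstep m n x y.

(* The probability mass function of mu = sum_i alpha_i mu_i on the free
   product, each mu_i being pushed forward along the embedding of its factor. *)
Definition mix_step (r : nat) (gT : 'I_r -> finGroupType) (alpha : 'I_r -> R)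
    (mu : forall k, gT k -> R) (x : freeprod gT) : R :=
  \sum_(i < r) alpha i * \sum_(g : gT i | fp_in g == x) mu i g.

End StepDistribution.

Section RandomWalk.
Context (R : realType) (r : nat) (gT : 'I_r -> finGroupType).
Context (d : measure_display) (Omega : measurableType d).
Context (P : probability Omega R).
Variables (m : freeprod gT -> R) (Y : nat -> Omega -> freeprod gT).

Definition random_walk : Prop :=
  (forall n x, measurable [set w | Y n w = x]) /\
  (forall n (x : nat -> freeprod gT),
    P [set w | forall k, (k <= n)%N -> Y k w = x k] =
    ((x 0%N == 1%g)%:R * \prod_(k < n) m ((x k)^-1 * x k.+1)%g)%:E).

Variable S : forall k, {set gT k}.

Definition log_mgf (t : R) : R :=
  lim ((fun n : nat =>
    n%:R^-1 * ln (fine 'E_P[fun w => expR (t * (wlen S (Y n w))%:R)])) @ \oo).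

Definition rate_function (x : R) : \bar R :=
  ereal_sup [set (x * t - log_mgf t)%:E | t in [set: R]].

Definition v_min (rho : R) : R :=
  inf [set x : R | 0 <= x /\ (rate_function x <= (ln rho)%:E)%E].

End RandomWalk.

Section BranchingRandomWalk.
Context (R : realType).

Definition offspring_law (pi : nat -> R) (rho : R) : Prop :=
  [/\ forall k, 0 <= pi k,
      (\sum_(0 <= k <oo) (pi k)%:E = 1)%E,
      (\sum_(0 <= k <oo) (k%:R * pi k)%:E = rho%:E)%E,
      1 < rho
    & pi 0%N = 0].

(* Ulam-Harris labels: the root is [::], the children of v are rcons v i for
   i = 0, 1, 2, ..., the generation of v is size v and its ancestor in
   generation k <= size v is take k v. *)
Definition vertex := seq nat.

Context (r : nat) (gT : 'I_r -> finGroupType).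
Context (d : measure_display) (Omega : measurableType d).
Context (P : probability Omega R).
Variables (pi : nat -> R) (m : freeprod gT -> R).
(* N v is the offspring number and zeta v the displacement attached to v. *)
Variables (N : vertex -> Omega -> nat) (zeta : vertex -> Omega -> freeprod gT).

Definition gw_tree (w : Omega) : set vertex :=
  [set v | forall k, (k < size v)%N -> (nth 0%N v k < N (take k v) w)%N].

(* The offspring numbers are i.i.d. with law pi. *)
Definition gw_offspring : Prop :=
  (forall v k, measurable [set w | N v w = k]) /\
  (forall (s : seq vertex) (k : vertex -> nat), uniq s ->
    P [set w | forall v, v \in s -> N v w = k v] =
    (\prod_(v <- s) pi (k v))%:E).

Definition sigma_tree : set (set Omega) :=
  <<s [set A | exists v, A = [set w | gw_tree w v]] >>.

(* Given the tree, the displacements of its vertices are i.i.d. with law m.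
   Nothing is required of zeta v outside the event that v is in the tree. *)
Definition iid_given_tree : Prop :=
  (forall v x, measurable [set w | gw_tree w v /\ zeta v w = x]) /\
  (forall (s : seq vertex) (x : vertex -> freeprod gT) (A : set Omega),
    uniq s -> sigma_tree A ->
    A `<=` [set w | forall v, v \in s -> gw_tree w v] ->
    P (A `&` [set w | forall v, v \in s -> zeta v w = x v]) =
    (P A * (\prod_(v <- s) m (x v))%:E)%E).

Definition branching_random_walk : Prop := gw_offspring /\ iid_given_tree.

Definition position (v : vertex) (w : Omega) : freeprod gT :=
  (\prod_(k < size v) zeta (take k.+1 v) w)%g.

Variable S : forall k, {set gT k}.

Definition min_position (n : nat) (w : Omega) : nat :=
  nat_min [set wlen S (position v w) | v in
    [set v | gw_tree w v /\ size v = n]].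

End BranchingRandomWalk.

(* Main.v *)
Require Import Defs.
From HB Require Import structures.
From mathcomp Require Import all_boot all_order all_fingroup all_algebra.
From mathcomp Require Import all_classical all_reals all_analysis.
From mathcomp Require Import measurable_realfun.
From mathcomp Require Import ring lra zify.

(** Everything rests on two facts: the word length is subadditive and the step
    law has finite support. Write |Y_n| for the length of the walk at time n,
    h for the logarithm of rho, and v for the value of v_min.

    The cumulant limit exists at each t by Fekete's lemma [cgf_ex], since the
    moments of the length are submultiplicative for t >= 0 and
    supermultiplicative for t <= 0. The speed of the walk is a subgradient of
    the limit at 0 [speed_ex]: the rate vanishes there, so that v is at most
    the speed, and below v the rate exceeds h by means of negative t only.

    Lower bound. For x < v the expected number of particles of generation n
    with length at most x n is rho^n P(|Y_n| <= x n), which decays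
    geometrically by the exponential Markov inequality at such a negative t.

    Upper bound. For y > v there is n0 with rho^n0 P(|Y_n0| <= n0 y) > 1.
    Otherwise the lower tails at y would decay at rate h or faster; as pieces
    of the walk can be concatenated, the pairs (n, - ln P(|Y_n| <= j)) are
    closed under addition up to an inequality, and a separating line through a
    point slightly below y bounds the cumulant limit at its slope t < 0 by too
    small a value [lower_tail_dual]. Given such n0, the particles which in
    each block of n0 generations move by at most n0 y form a supercritical
    branching process. It survives with positive probability only, but each of
    the many particles of an early generation of order n / e starts an
    independent copy, and the probability that all of them die out is
    geometric in n [branch_upper_bound]. The Borel-Cantelli lemma concludes in
    both cases.

    The probabilities of the branching walk enter through one identity
    [all_in_prob]: the probability that all particles of generation n are in a
    set is the n-th iterate, at the indicator of the set, of the operator that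
    averages over a step and then applies the offspring generating function.
    It comes from exploring the tree vertex by vertex [explore_vertex],
    because finitely many explored vertices have a product law. The union
    bound and its converse for weights close to 1 are inequalities for this
    operator. *)

Set Implicit Arguments.
Unset Strict Implicit.
Unset Printing Implicit Defensive.

Import Order.TTheory GRing.Theory Num.Theory.
Import numFieldNormedType.Exports.

Local Open Scope classical_set_scope.
Local Open Scope ring_scope.

(** * Subadditive sequences *)

Section Subadditive.
Context (R : realType).
Implicit Types u v : nat -> R.

Definition mean_seq u : nat -> R := fun n => n%:R^-1 * u n.

(** Only a bound up to an additive constant is asked of the upper estimate,
    because such a constant disappears after division by n. *)
Lemma mean_seq_cvg u (l : R) :
  (forall n, n%:R * l <= u n) ->
  (forall e, 0 < e -> exists C, forall n, u n <= n%:R * (l + e) + C) ->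
  mean_seq u @ \oo --> l.
Proof.
move=> lo up; apply/cvgrPdist_le => e e0.
have [C hC] := up (e / 2) (divr_gt0 e0 (ltr0n _ 2)).
have C1 : 0 < `|C| + 1 by rewrite ltr_pwDr.
near=> n.
have n0 : (0 < n%:R :> R) by rewrite ltr0n; near: n; exists 1%N.
have nC : 2 * (`|C| + 1) / e <= n%:R by near: n; exact: nbhs_infty_ger.
rewrite distrC ler_norml /mean_seq; apply/andP; split.
  have : l <= n%:R^-1 * u n by rewrite ler_pdivlMl // lo.
  lra.
suff : n%:R^-1 * u n <= l + e by lra.
rewrite ler_pdivrMl //; apply: le_trans (hC n) _.
move: nC; rewrite ler_pdivrMr // => nC.
have := ler_norm C; nra.
Unshelve. all: by end_near.
Qed.

(** Fekete's lemma: the limit is the infimum, so that it also bounds every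
    term from below. *)
Lemma fekete u (K : R) :
  (forall n k, u (n + k)%N <= u n + u k) ->
  (forall n, n%:R * K <= u n) ->
  exists l : R, mean_seq u @ \oo --> l /\ forall n, n%:R * l <= u n.
Proof.
move=> sub lo.
pose A := [set mean_seq u n | n in [set n | (0 < n)%N]].
have A0 : A !=set0 by exists (mean_seq u 1), 1%N.
have Alb : has_lbound A.
  by exists K => _ [n /= n0 <-]; rewrite /mean_seq ler_pdivlMl ?ltr0n.
have Ainf : forall n, (n%:R * inf A <= u n).
  case=> [|n]; first by rewrite mul0r; have := sub 0%N 0%N; rewrite addn0; lra.
  rewrite -ler_pdivlMl ?ltr0n //; apply: ge_inf => //.
  by exists n.+1.
exists (inf A); split=> //; apply: mean_seq_cvg => // e e0.
have [|_ [n0 /= n0p <-] hn0] := @inf_adherent _ A e e0 => //.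
have {}hn0 : u n0 <= n0%:R * (inf A + e).
  by rewrite -ler_pdivrMl ?ltr0n // ltW.
have mult q k : u (q * n0 + k)%N <= q%:R * u n0 + u k.
  elim: q => [|q ih]; first by rewrite mul0n mul0r !add0r.
  rewrite mulSn -addnA -(addn1 q) natrD mulrDl mul1r.
  by have := sub n0 (q * n0 + k)%N; lra.
exists (\sum_(i < n0) `|u i| + n0%:R * `|inf A + e|) => n.
rewrite {1 2}(divn_eq n n0).
have rlt : (n %% n0 < n0)%N by rewrite ltn_pmod.
set q := (n %/ n0)%N; set k := (n %% n0)%N in rlt *.
have uk : u k <= \sum_(i < n0) `|u i|.
  rewrite (bigD1 (Ordinal rlt)) //=.
  have := ler_norm (u k).
  have : 0 <= \sum_(i < n0 | i != Ordinal rlt) `|u i| by apply: sumr_ge0.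
  lra.
apply: le_trans (mult q k) _.
rewrite natrD natrM.
have : q%:R * u n0 <= q%:R * (n0%:R * (inf A + e)) by rewrite ler_wpM2l.
have : - (n0%:R * `|inf A + e|) <= k%:R * (inf A + e).
  have : k%:R * `|inf A + e| <= n0%:R * `|inf A + e|.
    by rewrite ler_wpM2r // ler_nat ltnW.
  have : - (k%:R * `|inf A + e|) <= k%:R * (inf A + e).
    by rewrite -mulrN ler_wpM2l // lerNl -normrN ler_norm.
  lra.
nra.
Qed.

Lemma mean_seqN u : mean_seq (fun n => - u n) = (fun n => - mean_seq u n).
Proof. by apply/funext => n; rewrite /mean_seq mulrN. Qed.

Lemma fekete_super u (K : R) :
  (forall n k, u n + u k <= u (n + k)%N) ->
  (forall n, u n <= n%:R * K) ->
  exists l : R, mean_seq u @ \oo --> l /\ forall n, u n <= n%:R * l.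
Proof.
move=> sup up; have [||l [cvl lel]] := @fekete (fun n => - u n) (- K).
- by move=> n k; rewrite -opprD lerN2 sup.
- by move=> n; rewrite mulrN lerN2 up.
exists (- l); split=> [|n]; last by have := lel n; lra.
have -> : mean_seq u = (fun n => - mean_seq (fun n => - u n) n).
  by rewrite mean_seqN; apply/funext => n; rewrite opprK.
exact: cvgN.
Qed.

Lemma mean_seq_lim_le u (l c C : R) :
  mean_seq u @ \oo --> l -> (forall n, u n <= n%:R * c + C) -> l <= c.
Proof.
move=> cu uc; apply/ler_addgt0Pr => e e0.
apply: (cvgr_to_le cu); near=> n.
have n0 : (0 < n%:R :> R) by rewrite ltr0n; near: n; exists 1%N.
have nC : `|C| / e <= n%:R by near: n; exact: nbhs_infty_ger.
rewrite /mean_seq ler_pdivrMl //; apply: le_trans (uc n) _.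
move: nC; rewrite ler_pdivrMr // => nC.
by have := ler_norm C; nra.
Unshelve. all: by end_near.
Qed.

End Subadditive.

(** * Word length *)

Section WordLength.
Context (r : nat) (gT : 'I_r -> finGroupType) (S : forall k, {set gT k}).
Local Open Scope group_scope.
Local Notation G := (freeprod gT).

(** Left multiplication is an automorphism of the Cayley graph. *)
Lemma path_cayley_mul (x a : G) s :
  path (cayley_edge S) a s ->
  path (cayley_edge S) (x * a) [seq x * y | y <- s].
Proof.
elim: s a => //= b s ih a /andP[ab bs]; rewrite ih // andbT.
by move: ab; rewrite /cayley_edge invMg -mulgA mulKg.
Qed.

Definition reachable (x : G) := exists s, path (cayley_edge S) 1 s /\ last 1 s = x.

Lemma reachable1 : reachable 1.
Proof. by exists [::]. Qed.

Lemma cat_path_mul (x y : G) s t :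
  path (cayley_edge S) 1 s -> last 1 s = x ->
  path (cayley_edge S) 1 t -> last 1 t = y ->
  path (cayley_edge S) 1 (s ++ [seq x * z | z <- t]) /\
  last 1 (s ++ [seq x * z | z <- t]) = x * y.
Proof.
move=> ps lx pt ly; rewrite cat_path ps lx /= last_cat lx.
have := @path_cayley_mul x 1 t pt; rewrite mulg1 => ->; split=> //.
by rewrite -{1}[x]mulg1 last_map ly.
Qed.

Lemma reachableM x y : reachable x -> reachable y -> reachable (x * y).
Proof.
move=> [s [ps ls]] [t [pt lt]].
by have [] := cat_path_mul ps ls pt lt; exists (s ++ [seq x * z | z <- t]).
Qed.

Lemma fp_in1 k : @fp_in r gT k 1 = 1.
Proof. by apply: val_inj; rewrite /= eqxx. Qed.

Hypothesis genS : forall k, symmetric_generating S k.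

Lemma reachable_fp_in k (g : gT k) : reachable (fp_in g).
Proof.
have [_ _ gen] := genS k.
have : g \in <<S k>> by rewrite gen inE.
move=> /gen_prodgP[n [c cS ->]].
elim: n c cS => [|n ih] c cS.
  by rewrite big_ord0 fp_in1; exact: reachable1.
rewrite big_ord_recl fp_inM; apply: reachableM; last by apply: ih => i.
exists [:: fp_in (c ord0)] => /=; split=> //; rewrite andbT /cayley_edge.
rewrite invg1 mul1g /is_generator; apply/existsP; exists k.
by apply/existsP; exists (c ord0); rewrite cS /=.
Qed.

(** The Cayley graph is connected, because each letter of a word is a product
    of generators of its factor. Hence the word length is never the default
    value of a minimum over the empty set. *)
Lemma reachable_all (x : G) : reachable x.
Proof.
case: x => w; elim: w => [|[k g] w ih] wr.
  have -> : exist _ [::] wr = 1 :> G by exact: val_inj.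
  exact: reachable1.
have wr' := reduced_behead wr.
have -> : exist _ (Tagged gT g :: w) wr = fp_in g * exist _ w wr' :> G.
  apply: val_inj => /=.
  have g1 : g != 1 by case/andP: wr => /= /andP[].
  rewrite (negPf g1) /word_mul /= /word_cons (negPf g1).
  case: w wr {ih wr'} => [|[l h] w] // /andP[_] /= /andP[/negPf + _].
  by rewrite eq_sym => ->.
by apply: reachableM (reachable_fp_in g) (ih wr').
Qed.

Local Notation L := (wlen S).

Lemma wlenP (x : G) : exists s, [/\ path (cayley_edge S) 1 s, last 1 s = x & size s = L x].
Proof.
have [s [ps ls]] := reachable_all x.
rewrite /wlen /cayley_dist.
set A := [set n | _]%classic.
have [|//] := @nat_minP A.
by exists (size s), s.
Qed.

Lemma wlen_le (x : G) s : path (cayley_edge S) 1 s -> last 1 s = x -> (L x <= size s)%N.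
Proof.
move=> ps ls; rewrite /wlen /cayley_dist.
set A := [set n | _]%classic.
have As : A (size s) by exists s.
have [|_] := @nat_minP A; first by exists (size s).
exact.
Qed.

Lemma wlen1 : L 1 = 0%N.
Proof. by apply/eqP; rewrite -leqn0 (@wlen_le 1 [::]). Qed.

Lemma wlenM (x y : G) : (L (x * y)%g <= L x + L y)%N.
Proof.
have [s [ps ls <-]] := wlenP x; have [t [pt lt <-]] := wlenP y.
have [pst lst] := cat_path_mul ps ls pt lt.
by have := wlen_le pst lst; rewrite size_cat size_map.
Qed.

End WordLength.

(** * Averaging along a finitely supported random walk *)

Section Walk.
Context (R : realType) (G : groupType) (F : seq G) (m : G -> R).
Hypotheses (m_ge0 : forall y, 0 <= m y) (m_sum1 : \sum_(y <- F) m y = 1).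
Implicit Types (h : G -> R) (x y z : G).

Definition walk_step h x : R := \sum_(y <- F) m y * h (x * y)%g.

(** The expectation of h at the position at time n of the walk with step law m
    started at the identity. *)
Definition walk_mean n h : R := iter n walk_step h 1%g.

Lemma walk_step_le h h' x :
  (forall y, y \in F -> h (x * y)%g <= h' (x * y)%g) ->
  walk_step h x <= walk_step h' x.
Proof.
move=> hh; rewrite /walk_step !big_seq; apply: ler_sum => y yF.
by rewrite ler_wpM2l // hh.
Qed.

Lemma iter_walk_step_le n h h' :
  (forall z, h z <= h' z) -> forall x, iter n walk_step h x <= iter n walk_step h' x.
Proof.
by move=> hh; elim: n => //= n ih x; apply: walk_step_le => y _; exact: ih.
Qed.

Lemma walk_step_affine a b h x :
  walk_step (fun z => a * h z + b) x = a * walk_step h x + b.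
Proof.
rewrite /walk_step -[in RHS](mulr1 b) -m_sum1 !mulr_sumr -big_split /=.
by apply: eq_bigr => y _; ring.
Qed.

Lemma iter_walk_step_affine n a b h x :
  iter n walk_step (fun z => a * h z + b) x = a * iter n walk_step h x + b.
Proof.
elim: n x => //= n ih x; rewrite -walk_step_affine.
by congr (walk_step _ x); apply/funext => z; exact: ih.
Qed.

Lemma iter_walk_step_scale n a h x :
  iter n walk_step (fun z => a * h z) x = a * iter n walk_step h x.
Proof.
rewrite -[RHS]addr0 -iter_walk_step_affine.
by congr (iter n walk_step _ x); apply/funext => z; rewrite addr0.
Qed.

Lemma iter_walk_step_sum (I : Type) (s : seq I) n (h : I -> G -> R) x :
  iter n walk_step (fun z => \sum_(i <- s) h i z) x =
  \sum_(i <- s) iter n walk_step (h i) x.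
Proof.
elim: n x => //= n ih x; rewrite /walk_step exchange_big /=.
by apply: eq_bigr => y _; rewrite ih mulr_sumr.
Qed.

Lemma iter_walk_step_cst n (c : R) x : iter n walk_step (fun=> c) x = c.
Proof.
transitivity (0 * iter n walk_step (fun=> 0) x + c); last by rewrite mul0r add0r.
rewrite -iter_walk_step_affine; congr (iter n walk_step _ x).
by apply/funext => z; rewrite mul0r add0r.
Qed.

Lemma iter_walk_step_translate n h g x :
  iter n walk_step (fun z => h (g * z)%g) x = iter n walk_step h (g * x)%g.
Proof.
elim: n x => //= n ih x; rewrite /walk_step.
by apply: eq_bigr => y _; rewrite ih mulgA.
Qed.

Lemma iter_walk_stepE n h g :
  iter n walk_step h g = walk_mean n (fun z => h (g * z)%g).
Proof. by rewrite /walk_mean iter_walk_step_translate mulg1. Qed.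

Lemma walk_mean_le n h h' : (forall z, h z <= h' z) -> walk_mean n h <= walk_mean n h'.
Proof. by move=> hh; exact: iter_walk_step_le. Qed.

Lemma walk_mean_ge0 n h : (forall z, 0 <= h z) -> 0 <= walk_mean n h.
Proof.
by move=> h0; rewrite -(iter_walk_step_cst n 0 1%g); exact: walk_mean_le.
Qed.

Lemma walk_mean_add n k h :
  walk_mean (n + k) h = walk_mean n (fun x => walk_mean k (fun z => h (x * z)%g)).
Proof.
rewrite /walk_mean iterD; congr (iter n walk_step _ 1%g).
by apply/funext => x; rewrite iter_walk_stepE.
Qed.

Lemma walk_mean_affine n a b h :
  walk_mean n (fun z => a * h z + b) = a * walk_mean n h + b.
Proof. exact: iter_walk_step_affine. Qed.

Lemma walk_mean_scale n a h : walk_mean n (fun z => a * h z) = a * walk_mean n h.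
Proof. exact: iter_walk_step_scale. Qed.

(** The two pieces of the walk before and after time n are independent. *)
Lemma walk_mean_super n k h h1 h2 :
  (forall z, 0 <= h1 z) -> (forall x y, h1 x * h2 y <= h (x * y)%g) ->
  walk_mean n h1 * walk_mean k h2 <= walk_mean (n + k) h.
Proof.
move=> h10 hh; rewrite walk_mean_add mulrC -walk_mean_scale.
apply: walk_mean_le => x; rewrite mulrC -walk_mean_scale.
exact: walk_mean_le.
Qed.

Lemma walk_mean_sub n k h h1 h2 :
  (forall x y, h (x * y)%g <= h1 x * h2 y) ->
  walk_mean (n + k) h <= walk_mean n h1 * walk_mean k h2.
Proof.
move=> hh; rewrite walk_mean_add mulrC -walk_mean_scale.
apply: walk_mean_le => x; rewrite mulrC -walk_mean_scale.
exact: walk_mean_le.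
Qed.

Context (L : G -> nat) (K : nat).
Hypotheses (L1 : L 1%g = 0%N) (LM : forall x y, (L (x * y)%g <= L x + L y)%N).
Hypothesis LK : forall y, y \in F -> (L y <= K)%N.

(** The walk moves by at most K at each step. *)
Lemma iter_walk_step_le_ball n h h' x :
  (forall z, (L z <= L x + n * K)%N -> h z <= h' z) ->
  iter n walk_step h x <= iter n walk_step h' x.
Proof.
elim: n x => [|n ih] x hh /=; first by apply: hh; rewrite addn0.
apply: walk_step_le => y yF; apply: ih => z zl; apply: hh.
by apply: leq_trans zl _; have := LM x y; have := LK yF; lia.
Qed.

Lemma walk_mean_le_ball n h h' :
  (forall z, (L z <= n * K)%N -> h z <= h' z) -> walk_mean n h <= walk_mean n h'.
Proof. by move=> hh; apply: iter_walk_step_le_ball => z; rewrite L1 => /hh. Qed.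

End Walk.

(** * Exponential moments and lower tails of the length *)

Section Tails.
Context (R : realType) (G : groupType) (F : seq G) (m : G -> R).
Hypotheses (m_ge0 : forall y, 0 <= m y) (m_sum1 : \sum_(y <- F) m y = 1).
Context (L : G -> nat) (K : nat).
Hypotheses (L1 : L 1%g = 0%N) (LM : forall x y, (L (x * y)%g <= L x + L y)%N).
Hypothesis LK : forall y, y \in F -> (L y <= K)%N.
Local Notation E := (walk_mean F m).

(** The moment generating function of the length at time n. *)
Definition mgf n t : R := E n (fun z => expR (t * (L z)%:R)).

(** The probability that the length at time n is at most c. *)
Definition lower_tail n c : R := E n (fun z => ((L z)%:R <= c :> R)%:R).

(** The limiting cumulant generating function, as a relation because the
    existence of the limit is yet to be shown. *)
Definition cgf_is t (l : R) : Prop := mean_seq (fun n => ln (mgf n t)) @ \oo --> l.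

Lemma mgf_bounds n t :
  expR (- (n%:R * (K%:R * `|t|))) <= mgf n t <= expR (n%:R * (K%:R * `|t|)).
Proof.
have b z : (L z <= n * K)%N -> `|t * (L z)%:R| <= n%:R * (K%:R * `|t|).
  move=> zl; rewrite normrM normr_nat mulrC mulrA ler_wpM2r //.
  by rewrite -natrM ler_nat.
rewrite -(iter_walk_step_cst m_sum1 n (expR _) 1%g) -[X in _ <= _ <= X](iter_walk_step_cst m_sum1 n _ 1%g).
apply/andP; split; apply: (walk_mean_le_ball m_ge0 L1 LM LK) => z /b;
  by rewrite ler_norml ler_expR => /andP[].
Qed.

Lemma mgf_gt0 n t : 0 < mgf n t.
Proof. by have /andP[+ _] := mgf_bounds n t; apply: lt_le_trans; exact: expR_gt0. Qed.

Lemma ln_mgf_bounds n t :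
  n%:R * (- (K%:R * `|t|)) <= ln (mgf n t) <= n%:R * (K%:R * `|t|).
Proof.
have /andP[lo up] := mgf_bounds n t.
rewrite mulrN -[X in X <= _]expRK -[X in _ <= _ <= X]expRK.
by rewrite !ler_ln ?posrE ?expR_gt0 ?mgf_gt0 // lo up.
Qed.

(** Since the length is subadditive, the moments are supermultiplicative for
    nonpositive t and submultiplicative for nonnegative t. *)
Lemma cgf_ex t :
  exists l, cgf_is t l /\ (t <= 0 -> forall n, ln (mgf n t) <= n%:R * l).
Proof.
have LMr x y : ((L (x * y)%g)%:R <= (L x)%:R + (L y)%:R :> R).
  by rewrite -natrD ler_nat.
have [t0|t0] := leP t 0.
  have [||l [cl le_l]] := @fekete_super R (fun n => ln (mgf n t)) (K%:R * `|t|).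
  - move=> n k; rewrite -lnM ?posrE ?mgf_gt0 // ler_ln ?posrE ?mulr_gt0 ?mgf_gt0 //.
    apply: walk_mean_super => // x y.
    by rewrite -expRD ler_expR -mulrDr ler_wnM2l.
  - by move=> n; have /andP[] := ln_mgf_bounds n t.
  by exists l.
have [||l [cl le_l]] := @fekete R (fun n => ln (mgf n t)) (- (K%:R * `|t|)).
- move=> n k; rewrite -lnM ?posrE ?mgf_gt0 // ler_ln ?posrE ?mulr_gt0 ?mgf_gt0 //.
  apply: walk_mean_sub => // x y.
  by rewrite -expRD ler_expR -mulrDr ler_wpM2l // ltW.
- by move=> n; have /andP[] := ln_mgf_bounds n t.
by exists l; split=> // t'; have := lt_le_trans t0 t'; rewrite ltxx.
Qed.

(** The speed of the walk is a subgradient of the limiting cumulant function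
    at 0, by Jensen's inequality for the exponential. *)
Lemma speed_ex : exists2 v, 0 <= v & forall t l, cgf_is t l -> t * v <= l.
Proof.
pose b n := E n (fun z => (L z)%:R).
have b0 n : 0 <= b n by apply: (walk_mean_ge0 m_ge0 m_sum1) => z.
have [||v [cv le_v]] := @fekete R b 0.
- move=> n k; rewrite /b walk_mean_add //.
  have -> : b n + b k = E n (fun x => 1 * (L x)%:R + b k).
    by rewrite walk_mean_affine // mul1r.
  apply: walk_mean_le => // x.
  have -> : 1 * (L x)%:R + b k = E k (fun z => 1 * (L z)%:R + (L x)%:R).
    by rewrite walk_mean_affine // !mul1r addrC.
  by apply: walk_mean_le => // y; rewrite mul1r -natrD ler_nat addnC.
- by move=> n; rewrite mulr0.
exists v; first by apply: (cvgr_to_ge cv); near=> n; rewrite mulr_ge0.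
move=> t l cl.
have jensen n : t * b n <= ln (mgf n t).
  rewrite -[X in X <= _]expRK ler_ln ?posrE ?expR_gt0 ?mgf_gt0 //.
  have e0 := expR_gt0 (t * b n).
  have -> : expR (t * b n) = E n (fun z => (expR (t * b n) * t) * (L z)%:R +
     expR (t * b n) * (1 - t * b n)).
    by rewrite walk_mean_affine // -/(b n); ring.
  apply: walk_mean_le => // z.
  rewrite -[X in _ <= expR X](subrK (t * b n)) expRD.
  rewrite mulrC [X in _ <= X]mulrC -subr_ge0.
  have -> : expR (t * b n) * expR (t * (L z)%:R - t * b n) -
    ((L z)%:R * (expR (t * b n) * t) + expR (t * b n) * (1 - t * b n)) =
    expR (t * b n) * (expR (t * (L z)%:R - t * b n) -
      (1 + (t * (L z)%:R - t * b n))) by ring.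
  by rewrite mulr_ge0 ?subr_ge0 ?expR_ge1Dx // ltW.
apply: (ler_cvg_to (cvgM (cvg_cst t) cv) cl); near=> n.
change (t * (n%:R^-1 * b n) <= n%:R^-1 * ln (mgf n t)).
by rewrite mulrCA ler_wpM2l // jensen.
Unshelve. all: by end_near.
Qed.

Lemma lower_tail_ge0 n c : 0 <= lower_tail n c.
Proof. exact: walk_mean_ge0. Qed.

Lemma lower_tail_le n c c' : c <= c' -> lower_tail n c <= lower_tail n c'.
Proof.
move=> cc; apply: walk_mean_le => // z; rewrite ler_nat.
by case: (leP _ c) => //= zc; rewrite (le_trans zc cc).
Qed.

Lemma lower_tail_le1 n c : lower_tail n c <= 1.
Proof.
rewrite -(iter_walk_step_cst m_sum1 n 1 1%g); apply: walk_mean_le => // z.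
by rewrite lern1 leq_b1.
Qed.

Lemma lower_tail1 n c : (n * K)%:R <= c -> lower_tail n c = 1.
Proof.
move=> nc; apply/eqP; rewrite eq_le lower_tail_le1 /=.
rewrite -(iter_walk_step_cst m_sum1 n 1 1%g).
apply: (walk_mean_le_ball m_ge0 L1 LM LK) => z zl.
by rewrite (le_trans _ nc) // ler_nat.
Qed.

Lemma lower_tailM n k c c' :
  lower_tail n c * lower_tail k c' <= lower_tail (n + k) (c + c').
Proof.
apply: walk_mean_super => // x y.
rewrite -natrM ler_nat mulnb.
case: (leP _ c) => //= xc; case: (leP _ c') => //= yc.
by rewrite (le_trans _ (lerD xc yc)) // -natrD ler_nat.
Qed.

Lemma lower_tailX a n c : lower_tail n c ^+ a <= lower_tail (a * n) (a%:R * c).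
Proof.
elim: a => [|a ih]; first by rewrite expr0 lower_tail1 ?mul0n ?mul0r.
rewrite exprS mulSn -add1n natrD mulrDl mul1r.
apply: le_trans (lower_tailM _ _ _ _).
by rewrite ler_wpM2l // lower_tail_ge0.
Qed.

(** The exponential Markov inequality. *)
Lemma lower_tail_chernoff n c t :
  t <= 0 -> lower_tail n c <= expR (- (t * c)) * mgf n t.
Proof.
move=> t0; rewrite -walk_mean_scale //; apply: walk_mean_le => // z.
rewrite -expRD; case: (leP _ c) => /= zc; last exact: expR_ge0.
apply: le_trans (expR_ge1Dx _); rewrite lerDl addrC -mulrBr.
by rewrite mulr_le0 // subr_le0.
Qed.

(** The length of the walk at time n takes at most n K + 1 values. *)
Lemma mgf_le_sum n t : t <= 0 ->
  mgf n t <= \sum_(j < (n * K).+1) expR (t * j%:R) * lower_tail n j%:R.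
Proof.
move=> t0; rewrite /lower_tail; under eq_bigr do rewrite -walk_mean_scale //.
rewrite -(iter_walk_step_sum F m).
apply: (walk_mean_le_ball m_ge0 L1 LM LK) => z zl.
rewrite (bigD1 (Ordinal (zl : (L z < (n * K).+1)%N))) //= lexx mulr1 lerDl.
by apply: sumr_ge0 => j _; rewrite mulr_ge0 ?expR_ge0.
Qed.

End Tails.

(** * Duality between lower tails and exponential moments *)

Section Duality.
Context (R : realType).

Lemma rational_between (x y : R) : 0 <= x -> x < y ->
  exists p q : nat, (0 < q)%N /\ x * q%:R < p%:R < y * q%:R.
Proof.
move=> x0 xy; pose q := (Num.trunc (y - x)^-1).+1.
have yx : 0 < y - x by rewrite subr_gt0.
have yxV : 0 <= (y - x)^-1 by rewrite invr_ge0 ltW.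
have /andP[_ qlt] := truncn_itv yxV.
have xq : 0 <= x * q%:R by rewrite mulr_ge0.
have /andP[ple plt] := truncn_itv xq.
exists (Num.trunc (x * q%:R)).+1, q; split=> //; rewrite plt /=.
rewrite -addn1 natrD.
have : 1 < (y - x) * q%:R by rewrite -ltr_pdivrMl ?mulr1.
lra.
Qed.

(** The points (D i, A i) span a cone that avoids the open lower half of the
    vertical axis, so that a line through the origin separates them from it.
    The third hypothesis keeps this line from being vertical. *)
Lemma separating_slope (I : Type) (P : I -> Prop) (D A : I -> R) (c : R) :
  (forall i j, P i -> P j -> D i < 0 -> 0 < D j -> 0 <= D j * A i - D i * A j) ->
  (forall i, P i -> D i = 0 -> 0 <= A i) ->
  (forall i, P i -> 0 < D i -> c * D i <= A i) ->
  (exists2 i, P i & 0 < D i /\ A i < 0) ->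
  exists2 t, t < 0 & forall i, P i -> t * D i <= A i.
Proof.
move=> cone axis lo [i0 Pi0 [Di0 Ai0]].
pose B := [set A i / D i | i in [set i | P i /\ 0 < D i]].
have Blb : has_lbound B.
  by exists c => _ [i [Pi Di] <-]; rewrite ler_pdivlMr // lo.
have B0 : B !=set0 by exists (A i0 / D i0), i0.
have tB i : P i -> 0 < D i -> inf B <= A i / D i.
  by move=> Pi Di; apply: ge_inf => //; exists i.
exists (inf B) => [|i Pi].
  by apply: le_lt_trans (tB i0 Pi0 Di0) _; rewrite pmulr_llt0 ?invr_gt0.
have [Di|Di|Di] := ltgtP (D i) 0.
- suff : A i / D i <= inf B by rewrite ler_ndivrMr.
  apply: lb_le_inf => // _ [j [Pj Dj] <-].
  rewrite ler_pdivlMr // mulrAC ler_ndivrMr //.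
  by have := cone i j Pi Pj Di Dj; lra.
- by rewrite -ler_pdivlMr // tB.
- by rewrite Di mulr0 axis.
Qed.

Context (G : groupType) (F : seq G) (m : G -> R).
Hypotheses (m_ge0 : forall y, 0 <= m y) (m_sum1 : \sum_(y <- F) m y = 1).
Context (L : G -> nat) (K : nat).
Hypotheses (L1 : L 1%g = 0%N) (LM : forall x y, (L (x * y)%g <= L x + L y)%N).
Hypothesis LK : forall y, y \in F -> (L y <= K)%N.
Local Notation low := (lower_tail F m L).

(** Each pair (n, j) for which the length at time n is at most j with positive
    probability gives a point (D, A): D is q j - p n, where y = p / q, and A
    is the negative logarithm of this probability minus h n. Independent
    pieces of the walk may be concatenated, so that these points can be added.
    Two points on opposite sides of the axis D = 0 have a combination on it
    with natural coefficients, since y is rational; there the length is at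
    most y n, and the decay assumed at y1 gives A >= 0. The gap between y and
    y1 keeps the separating line from being vertical. *)
Lemma lower_tail_line (h y y1 : R) (p q : nat) :
  0 < h -> (0 < q)%N -> y * q%:R = p%:R -> y < y1 ->
  (forall n, (0 < n)%N -> low n (n%:R * y1) <= expR (- (n%:R * h))) ->
  exists2 t, t < 0 &
    forall n j : nat, low n j%:R <= expR (n%:R * (t * y - h) - t * j%:R).
Proof.
move=> h0 q0 yq yy1 small.
have q0' : 0 < q%:R :> R by rewrite ltr0n.
have low_ge0 n c : 0 <= low n c by exact: lower_tail_ge0.
have low_le1 n c : low n c <= 1 by exact: lower_tail_le1.
pose P (i : nat * nat) := 0 < low i.1 i.2%:R.
pose D (i : nat * nat) : R := q%:R * i.2%:R - p%:R * i.1%:R.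
pose A (i : nat * nat) : R := - ln (low i.1 i.2%:R) - h * i.1%:R.
have smallN n c : (0 < n)%N -> c <= n%:R * y1 -> 0 < low n c ->
    n%:R * h <= - ln (low n c).
  move=> n0 cn lc; rewrite lerNr -[X in _ <= X]expRK ler_ln ?posrE ?expR_gt0 //.
  by apply: le_trans (small n n0); exact: lower_tail_le.
have bnd i : P i -> (i.1 > 0)%N -> i.2%:R <= i.1%:R * y1 -> 0 <= A i.
  by move=> Pi i0 /(smallN _ _ i0) /(_ Pi); rewrite /A; lra.
have [||||t t0 tA] := @separating_slope _ P D A (- (h / (q%:R * (y1 - y)))).
- move=> [n j] [n' j'] Pi Pj; rewrite /D /= => Di Dj.
  have pq : (q * j < p * n)%N by rewrite -(ltr_nat R) !natrM; lra.
  have pq' : (p * n' < q * j')%N by rewrite -(ltr_nat R) !natrM; lra.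
  pose a := (q * j' - p * n')%N; pose b := (p * n - q * j)%N.
  have aE : a%:R = q%:R * j'%:R - p%:R * n'%:R :> R by rewrite natrB ?natrM // ltnW.
  have bE : b%:R = p%:R * n%:R - q%:R * j%:R :> R by rewrite natrB ?natrM // ltnW.
  rewrite -aE (_ : q%:R * j%:R - p%:R * n%:R = - b%:R :> R); last first.
    by rewrite bE opprB.
  have N0 : (0 < a * n + b * n')%N.
    rewrite addn_gt0 muln_gt0 /a subn_gt0 pq' /=.
    by case: (n) pq => [|//]; rewrite muln0.
  have lowN : low n j%:R ^+ a * low n' j'%:R ^+ b <=
      low (a * n + b * n') (a%:R * j%:R + b%:R * j'%:R).
    apply: le_trans (lower_tailM _ _ _ _ _ _ _) => //.
    by apply: ler_pM; rewrite ?exprn_ge0 ?lower_tail_ge0 //; apply: (lower_tailX _ _ L1 LM LK).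
  have pos : 0 < low n j%:R ^+ a * low n' j'%:R ^+ b by rewrite mulr_gt0 ?exprn_gt0.
  have lnN : ln (low n j%:R) * a%:R + ln (low n' j'%:R) * b%:R <=
      - ((a * n + b * n')%:R * h).
    rewrite !mulr_natr -!lnXn // -lnM ?posrE ?exprn_gt0 //.
    rewrite lerNr; apply: le_trans (smallN _ _ N0 _ (lt_le_trans pos lowN)) _.
      rewrite -(ler_pM2l q0').
      have -> : q%:R * (a%:R * j%:R + b%:R * j'%:R) =
        (a%:R * n%:R + b%:R * n'%:R) * (y * q%:R) by rewrite yq aE bE; ring.
      rewrite natrD !natrM; set k : R := a%:R * n%:R + b%:R * n'%:R.
      have : 0 <= k * q%:R * (y1 - y).
        by rewrite !mulr_ge0 ?subr_ge0 ?addr_ge0 ?mulr_ge0 // ltW.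
      lra.
    rewrite lerN2 ler_ln ?posrE //; exact: lt_le_trans lowN.
  rewrite /A /=; move: lnN; rewrite natrD !natrM; lra.
- move=> [n j] Pi; rewrite /D /= => D0.
  have [n0|n0] := posnP n.
    rewrite /A /= n0 mulr0 subr0 oppr_ge0 ln_le0 //.
  apply: bnd => //=.
  suff : q%:R * j%:R <= q%:R * (n%:R * y1) by rewrite ler_pM2l.
  have -> : q%:R * j%:R = n%:R * (y * q%:R) by rewrite yq; lra.
  have : 0 <= n%:R * q%:R * (y1 - y) by rewrite !mulr_ge0 // subr_ge0 ltW.
  lra.
- move=> [n j] Pi Di.
  have yp : 0 < q%:R * (y1 - y) by rewrite mulr_gt0 // subr_gt0.
  have An : - (h * n%:R) <= A (n, j).
    by rewrite /A /= lerBrDr addNr oppr_ge0 ln_le0.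
  rewrite mulNr mulrAC lerNl ler_pdivlMr //.
  have [jn|jn] := leP j%:R (n%:R * y1).
    have A0 : 0 <= A (n, j).
      have [n0|n0] := posnP n; last exact: bnd.
      by apply: le_trans An; rewrite n0 mulr0 oppr0.
    have : 0 <= A (n, j) * (q%:R * (y1 - y)) by rewrite mulr_ge0 // ltW.
    have : 0 <= h * D (n, j) by rewrite mulr_ge0 // ltW.
    lra.
  have : n%:R * (q%:R * (y1 - y)) <= D (n, j).
    rewrite /D /= -yq.
    have : q%:R * (n%:R * y1) <= q%:R * j%:R by rewrite ler_wpM2l // ltW.
    lra.
  have : - A (n, j) * (q%:R * (y1 - y)) <= h * n%:R * (q%:R * (y1 - y)).
    by apply: ler_wpM2r; [exact: ltW | rewrite lerNl].
  move=> le1 le2; apply: le_trans le1 _; rewrite -mulrA.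
  by rewrite ler_wpM2l // ltW.
- exists (1%N, (K + p.+1)%N).
    by rewrite /P /= (lower_tail1 m_ge0 m_sum1 L1 LM LK) // mul1n ler_nat leq_addr.
  rewrite /D /A /= (lower_tail1 m_ge0 m_sum1 L1 LM LK) ?mul1n ?ler_nat ?leq_addr //.
  rewrite ln1 oppr0 !mulr1 sub0r oppr_lt0 h0; split=> //.
  by rewrite subr_gt0 -natrM ltr_nat; nia.
exists (t * q%:R) => [|n j]; first by rewrite nmulr_rlt0.
have [lp|] := ltP 0 (low n j%:R); last by move=> /le_trans; apply; exact: expR_ge0.
rewrite -[leLHS]lnK ?posrE // ler_expR.
have := tA (n, j) lp; rewrite /D /A /= -yq; lra.
Qed.

(** If the lower tail at y1 decayed at rate h or faster, then, by convexity of
    the decay rate, all lower tails would lie below an exponential line of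
    some slope t < 0 through a point y < y1, and the cumulant limit at this t
    would be too small for the bound on the conjugate at x < y. *)
Lemma lower_tail_dual (h x y1 : R) :
  0 < h -> 0 <= x -> x < y1 ->
  (forall t l, cgf_is F m L t l -> x * t - l <= h) ->
  exists2 n, (0 < n)%N & expR (- (n%:R * h)) < low n (n%:R * y1).
Proof.
move=> h0 x0 xy1 conj; apply: contrapT => no.
have small n : (0 < n)%N -> low n (n%:R * y1) <= expR (- (n%:R * h)).
  by move=> n0; rewrite leNgt; apply/negP => lt; apply: no; exists n.
have [p [q [q0 /andP[xp py]]]] := rational_between x0 xy1.
have q0' : 0 < q%:R :> R by rewrite ltr0n.
pose y : R := p%:R / q%:R.
have yq : y * q%:R = p%:R by rewrite divfK // gt_eqF.
have xy : x < y by rewrite ltr_pdivlMr.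
have yy1 : y < y1 by rewrite ltr_pdivrMr.
have [t t0 line] := lower_tail_line h0 q0 yq yy1 small.
have [l [cl _]] := cgf_ex m_ge0 m_sum1 L1 LM LK t.
pose e := t * (x - y) / 2.
have e0 : 0 < e by rewrite divr_gt0 // nmulr_rgt0 // subr_lt0.
suff : l <= (t * y - h) + e by have := conj _ _ cl; move: e0; rewrite /e; lra.
apply: (mean_seq_lim_le (C := ln (1 + K%:R / e)) cl) => n.
have Ke : 0 <= K%:R / e by rewrite divr_ge0 // ltW.
have c0 : 0 < 1 + K%:R / e by lra.
rewrite -[n%:R * _]expRK -lnM ?posrE ?expR_gt0 //.
rewrite ler_ln ?posrE ?mulr_gt0 ?expR_gt0 // ?(mgf_gt0 m_ge0 m_sum1 L1 LM LK) //.
apply: le_trans (mgf_le_sum m_ge0 m_sum1 L1 LM LK n (ltW t0)) _.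
apply: (@le_trans _ _ (\sum_(j < (n * K).+1) expR (n%:R * (t * y - h)))).
  apply: ler_sum => j _.
  apply: (@le_trans _ _ (expR (t * j%:R) * expR (n%:R * (t * y - h) - t * j%:R))).
    by rewrite ler_wpM2l ?expR_ge0.
  by rewrite -expRD addrC subrK.
rewrite sumr_const card_ord -[leLHS]mulr_natr [n%:R * (_ + e)]mulrDr expRD -mulrA.
rewrite ler_wpM2l ?expR_ge0 //.
have e1 : 1 + n%:R * e <= expR (n%:R * e) by exact: expR_ge1Dx.
have : (1 + n%:R * e) * (1 + K%:R / e) <= expR (n%:R * e) * (1 + K%:R / e).
  by rewrite ler_pM2r.
apply: le_trans; rewrite -addn1 natrD natrM.
have -> : (1 + n%:R * e) * (1 + K%:R / e) = n%:R * K%:R + 1 + n%:R * e + K%:R / e.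
  by field; rewrite gt_eqF.
by rewrite -addrA lerDl addr_ge0 // mulr_ge0 // ltW.
Qed.

End Duality.

(** * Generating function of the offspring law *)

Section Pgf.
Context (R : realType) (pi : nat -> R) (rho : R).
Hypothesis offpi : offspring_law pi rho.

Definition pgf (s : R) : R := fine (\sum_(0 <= k <oo) (pi k * s ^+ k)%:E)%E.

Let pi_ge0 k : 0 <= pi k. Proof. by case: offpi. Qed.
Let pi_sum : (\sum_(0 <= k <oo) (pi k)%:E = 1)%E. Proof. by case: offpi. Qed.
Let pi_mean : (\sum_(0 <= k <oo) (k%:R * pi k)%:E = rho%:E)%E. Proof. by case: offpi. Qed.
Let pi0 : pi 0%N = 0. Proof. by case: offpi. Qed.

Lemma pgf_series s : 0 <= s <= 1 ->
  ((pgf s)%:E = \sum_(0 <= k <oo) (pi k * s ^+ k)%:E)%E.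
Proof.
move=> /andP[s0 s1]; rewrite /pgf fineK // ge0_fin_numE; last first.
  by apply: nneseries_ge0 => k _ _; rewrite lee_fin mulr_ge0 ?exprn_ge0.
apply: (@le_lt_trans _ _ 1%E); last exact: ltry.
rewrite -pi_sum; apply: lee_nneseries => k _.
  by rewrite lee_fin mulr_ge0 ?exprn_ge0.
by rewrite lee_fin ler_piMr // exprn_ile1.
Qed.

Lemma pgf_le s s' : 0 <= s -> s <= s' -> s' <= 1 -> pgf s <= pgf s'.
Proof.
move=> s0 ss s1; rewrite -lee_fin !pgf_series ?s0 ?(le_trans s0 ss) ?(le_trans ss s1) //.
apply: lee_nneseries => k _; first by rewrite lee_fin mulr_ge0 ?exprn_ge0.
by rewrite lee_fin ler_wpM2l // lerXn2r ?nnegrE // (le_trans s0 ss).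
Qed.

Lemma pgf1 : pgf 1 = 1.
Proof.
apply: EFin_inj; rewrite pgf_series ?ler01 ?lexx // -pi_sum.
by apply: eq_eseriesr => k _; rewrite expr1n mulr1.
Qed.

Lemma pgf_unit s : 0 <= s <= 1 -> 0 <= pgf s <= 1.
Proof.
move=> s01; have /andP[s0 s1] := s01.
rewrite -[X in _ <= _ <= X]pgf1 pgf_le // andbT -lee_fin pgf_series //.
by apply: nneseries_ge0 => k _ _; rewrite lee_fin mulr_ge0 ?exprn_ge0.
Qed.

Lemma pgf_ge0 s : 0 <= s <= 1 -> 0 <= pgf s.
Proof. by move=> /pgf_unit /andP[]. Qed.

Lemma pgf_compl_series s : 0 <= s <= 1 ->
  ((1 - pgf s)%:E = \sum_(0 <= k <oo) (pi k * (1 - s ^+ k))%:E)%E.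
Proof.
move=> s01; have /andP[s0 s1] := s01.
have : ((pgf s)%:E + \sum_(0 <= k <oo) (pi k * (1 - s ^+ k))%:E = 1)%E.
  rewrite pgf_series // -nneseriesD => [|k _ _|k _ _].
  - rewrite -pi_sum; apply: eq_eseriesr => k _.
    by rewrite -EFinD -mulrDr addrCA subrr addr0 mulr1.
  - by rewrite lee_fin mulr_ge0 ?exprn_ge0.
  - by rewrite lee_fin mulr_ge0 // subr_ge0 exprn_ile1.
by rewrite EFinB => <-; rewrite addeAC subee // add0e.
Qed.

Lemma bernoulli_le (s : R) k : 0 <= s <= 1 -> 1 - s ^+ k <= k%:R * (1 - s).
Proof.
move=> /andP[s0 s1]; elim: k => [|k ih]; first by rewrite expr0 subrr mul0r.
rewrite exprS -natr1.
have : 0 <= s ^+ k <= 1 by rewrite exprn_ge0 // exprn_ile1.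
by move=> /andP[sk0 sk1]; nra.
Qed.

Lemma bernoulli_ge (a : R) k : 0 <= a <= 1 ->
  k%:R * a - (k%:R * a) ^+ 2 <= 1 - (1 - a) ^+ k.
Proof.
move=> /andP[a0 a1]; suff : (1 - a) ^+ k <= 1 - k%:R * a + (k%:R * a) ^+ 2 by lra.
elim: k => [|k ih]; first by rewrite expr0 mul0r expr2; lra.
rewrite exprS; apply: (@le_trans _ _ ((1 - a) * (1 - k%:R * a + (k%:R * a) ^+ 2))).
  by rewrite ler_wpM2l // subr_ge0.
have k0 : 0 <= k%:R :> R by exact: ler0n.
rewrite -natr1 -subr_ge0.
have -> : 1 - (k%:R + 1) * a + ((k%:R + 1) * a) ^+ 2 -
   (1 - a) * (1 - k%:R * a + (k%:R * a) ^+ 2) =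
   a ^+ 2 * (k%:R + 1) + a * (k%:R * a) ^+ 2 by ring.
by rewrite addr_ge0 ?mulr_ge0 ?sqr_ge0 ?addr_ge0.
Qed.

Lemma pgf_compl_le s : 0 <= s <= 1 -> 1 - pgf s <= rho * (1 - s).
Proof.
move=> s01; have /andP[s0 s1] := s01.
rewrite -lee_fin pgf_compl_series // mulrC EFinM -pi_mean -nneseriesZl; last first.
  by move=> k _; rewrite lee_fin mulr_ge0.
apply: lee_nneseries => k _.
  by rewrite lee_fin mulr_ge0 // subr_ge0 exprn_ile1.
by rewrite -EFinM lee_fin mulrA [leRHS]mulrC ler_wpM2l // mulrC bernoulli_le.
Qed.

(** Only finitely many offspring numbers are needed for a mean above rho', and
    for them the derivative of the generating function at 1 is approached
    uniformly. *)
Lemma pgf_compl_ge rho' : rho' < rho ->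
  exists2 a0 : R, 0 < a0 <= 1 &
    forall a, 0 <= a <= a0 -> rho' * a <= 1 - pgf (1 - a).
Proof.
move=> rr.
have [M hM] : exists M, rho' < \sum_(0 <= k < M) k%:R * pi k.
  apply: contrapT => no.
  have : (rho%:E <= rho'%:E)%E.
    rewrite -pi_mean; apply: lime_le.
      by apply: is_cvg_nneseries => k _ _; rewrite lee_fin mulr_ge0.
    apply: nearW => M; rewrite sumEFin lee_fin leNgt; apply/negP => lt.
    by apply: no; exists M.
  by rewrite lee_fin leNgt rr.
pose S1 := \sum_(0 <= k < M) k%:R * pi k.
pose S2 := \sum_(0 <= k < M) k%:R ^+ 2 * pi k.
have S20 : 0 <= S2 by apply: sumr_ge0 => k _; rewrite mulr_ge0 // sqr_ge0.
have S2p : 0 < S2 + 1 by lra.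
have cp : 0 < (S1 - rho') / (S2 + 1) by rewrite divr_gt0 // subr_gt0.
exists (Num.min 1 ((S1 - rho') / (S2 + 1))).
  by rewrite lt_min ltr01 cp ge_min lexx.
move=> a /andP[a0]; rewrite le_min => /andP[a1 ac].
have a01 : 0 <= 1 - a <= 1 by rewrite subr_ge0 a1 gerBl a0.
have : \sum_(0 <= k < M) pi k * (1 - (1 - a) ^+ k) <= 1 - pgf (1 - a).
  rewrite -lee_fin pgf_compl_series // -sumEFin.
  apply: nneseries_lim_ge => k _ _; rewrite lee_fin mulr_ge0 // subr_ge0.
  by have /andP[? ?] := a01; rewrite exprn_ile1.
apply: le_trans.
apply: (@le_trans _ _ (\sum_(0 <= k < M) pi k * (k%:R * a - (k%:R * a) ^+ 2))); last first.
  by apply: ler_sum => k _; rewrite ler_wpM2l // bernoulli_ge // a0.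
have -> : \sum_(0 <= k < M) pi k * (k%:R * a - (k%:R * a) ^+ 2) = a * (S1 - a * S2).
  rewrite /S1 /S2 mulr_sumr -sumrB mulr_sumr.
  by apply: eq_bigr => k _; ring.
rewrite mulrC ler_wpM2l //.
move: ac; rewrite ler_pdivlMr // mulrDr; lra.
Qed.

(** Every vertex has a child, so that [pgf s / s] is a power series with
    nonnegative coefficients, hence nondecreasing in s. *)
Lemma pgf_ratio_le s s0 : 0 <= s -> s <= s0 -> 0 < s0 -> s0 <= 1 ->
  pgf s <= pgf s0 / s0 * s.
Proof.
move=> s_ge0 ss0 s0_gt0 s0_le1; rewrite mulrAC -mulrA -lee_fin EFinM muleC.
rewrite !pgf_series ?s_ge0 ?(ltW s0_gt0) ?(le_trans ss0 s0_le1) //.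
have q0 : 0 <= s / s0 by rewrite divr_ge0 // ltW.
rewrite -nneseriesZl; last first.
  by move=> k _; rewrite lee_fin mulr_ge0 ?exprn_ge0 // ltW.
apply: lee_nneseries => k _; first by rewrite lee_fin mulr_ge0 ?exprn_ge0.
rewrite -EFinM lee_fin; case: k => [|k]; first by rewrite pi0 !mul0r mulr0.
rewrite mulrCA ler_wpM2l // exprS [in leRHS]exprS mulrA divfK ?gt_eqF //.
by rewrite ler_wpM2l // lerXn2r ?nnegrE // ltW.
Qed.

End Pgf.

(** * Branching along the walk *)

Section Branching.
Context (R : realType) (pi : nat -> R) (rho : R).
Hypothesis offpi : offspring_law pi rho.
Context (G : groupType) (F : seq G) (m : G -> R).
Hypotheses (m_ge0 : forall y, 0 <= m y) (m_sum1 : \sum_(y <- F) m y = 1).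
Implicit Types (phi psi : G -> R) (x y z : G).
Local Notation Q := (walk_step F m).

(** If every particle alive at time n at z is given the weight [phi z], the
    expected product of the weights, for the process started at x, is
    [iter n branch_step phi x]. *)
Definition branch_step phi x : R := pgf pi (Q phi x).

Definition unit_valued phi := forall z, 0 <= phi z <= 1.

Lemma walk_step_unit phi : unit_valued phi -> unit_valued (Q phi).
Proof.
move=> phi01 x; have cst c := iter_walk_step_cst m_sum1 1 c x.
rewrite -{1}(cst 0) -[X in _ <= _ <= X](cst 1) /=.
by apply/andP; split; apply: walk_step_le => // y _; case/andP: (phi01 (x * y)%g).
Qed.

Lemma branch_step_unit phi : unit_valued phi -> unit_valued (branch_step phi).
Proof. by move=> phi01 x; apply: (pgf_unit offpi); exact: walk_step_unit. Qed.

Lemma iter_branch_unit n phi : unit_valued phi -> unit_valued (iter n branch_step phi).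
Proof. by move=> phi01; elim: n => //= n; exact: branch_step_unit. Qed.

Lemma branch_step_le phi psi x : unit_valued phi -> unit_valued psi ->
  (forall y, y \in F -> phi (x * y)%g <= psi (x * y)%g) ->
  branch_step phi x <= branch_step psi x.
Proof.
move=> phi01 psi01 le; apply: (pgf_le offpi); last first.
- by case/andP: (walk_step_unit psi01 x).
- exact: walk_step_le.
- by case/andP: (walk_step_unit phi01 x).
Qed.

Lemma iter_branch_le n phi psi x : unit_valued phi -> unit_valued psi ->
  (forall z, phi z <= psi z) -> iter n branch_step phi x <= iter n branch_step psi x.
Proof.
move=> phi01 psi01 le; elim: n x => //= n ih x.
by apply: branch_step_le => // *; exact: iter_branch_unit.
Qed.

Lemma iter_branch_translate n phi g x :
  iter n branch_step (fun z => phi (g * z)%g) x = iter n branch_step phi (g * x)%g.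
Proof.
elim: n x => //= n ih x; rewrite /branch_step /walk_step.
by congr pgf; apply: eq_bigr => y _; rewrite ih mulgA.
Qed.

Lemma walk_step_compl phi x : 1 - Q phi x = Q (fun z => 1 - phi z) x.
Proof.
have -> : 1 - Q phi x = - 1 * Q phi x + 1 by rewrite mulN1r addrC.
rewrite -(walk_step_affine m_sum1).
by congr (Q _ x); apply/funext => z; rewrite mulN1r addrC.
Qed.

(** The union bound. *)
Lemma iter_branch_compl_le n phi x : unit_valued phi ->
  1 - iter n branch_step phi x <= rho ^+ n * iter n Q (fun z => 1 - phi z) x.
Proof.
move=> phi01; have rho1 : 1 < rho by case: offpi.
elim: n x => [|n ih] x /=; first by rewrite mul1r.
apply: le_trans (pgf_compl_le offpi _) _.
  exact: walk_step_unit (iter_branch_unit n phi01) x.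
rewrite exprS -mulrA ler_wpM2l ?(le_trans ler01 (ltW rho1)) //.
rewrite walk_step_compl.
apply: (@le_trans _ _ (Q (fun z => rho ^+ n * iter n Q (fun z => 1 - phi z) z) x)).
  by apply: walk_step_le => // y _; exact: ih.
by have := iter_walk_step_scale m_sum1 1 (rho ^+ n) (iter n Q (fun z => 1 - phi z)) x => /= ->.
Qed.

(** The union bound is almost sharp for weights close to 1. *)
Lemma iter_branch_compl_ge rho' n a0 a phi x :
  0 <= rho' ->
  (forall b, 0 <= b <= a0 -> rho' * b <= 1 - pgf pi (1 - b)) ->
  0 <= a -> rho ^+ n * a <= a0 ->
  unit_valued phi -> (forall z, 1 - phi z <= a) ->
  rho' ^+ n * iter n Q (fun z => 1 - phi z) x <= 1 - iter n branch_step phi x.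
Proof.
move=> rho'0 lin a_ge0 + phi01 phia; have rho1 : 1 < rho by case: offpi.
have rho0 : 0 <= rho := le_trans ler01 (ltW rho1).
elim: n x => [|n ih] x ra /=; first by rewrite mul1r.
have ra' : rho ^+ n * a <= a0.
  apply: le_trans ra; rewrite exprS -mulrA ler_peMl ?mulr_ge0 ?exprn_ge0 //.
  exact: ltW.
have b01 := walk_step_unit (iter_branch_unit n phi01) x.
set b := 1 - Q (iter n branch_step phi) x.
have bE : b = Q (fun z => 1 - iter n branch_step phi z) x by exact: walk_step_compl.
have ba0 : 0 <= b <= a0.
  rewrite /b subr_ge0; have /andP[_ ->] := b01; rewrite -/b bE /=.
  apply: le_trans ra'.
  rewrite -(iter_walk_step_cst m_sum1 1 (rho ^+ n * a) x) /=.
  apply: walk_step_le => // y _; apply: le_trans (iter_branch_compl_le _ _ phi01) _.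
  rewrite ler_wpM2l ?exprn_ge0 // -[leRHS](iter_walk_step_cst m_sum1 n _ (x * y)%g).
  exact: iter_walk_step_le.
have bQ : 1 - b = Q (iter n branch_step phi) x by rewrite /b opprB addrC subrK.
have := lin b ba0; rewrite /branch_step bQ.
apply: le_trans; rewrite exprS -mulrA ler_wpM2l // bE.
apply: (@le_trans _ _ (Q (fun z => rho' ^+ n * iter n Q (fun z => 1 - phi z) z) x)).
  by have := iter_walk_step_scale m_sum1 1 (rho' ^+ n) (iter n Q (fun z => 1 - phi z)) x => /= ->.
by apply: walk_step_le => // y _; exact: ih.
Qed.

Context (L : G -> nat) (K : nat).
Hypotheses (L1 : L 1%g = 0%N) (LM : forall x y, (L (x * y)%g <= L x + L y)%N).
Hypothesis LK : forall y, y \in F -> (L y <= K)%N.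
Local Notation low := (lower_tail F m L).

Lemma iter_branch_le_ball n phi psi x : unit_valued phi -> unit_valued psi ->
  (forall z, (L z <= L x + n * K)%N -> phi z <= psi z) ->
  iter n branch_step phi x <= iter n branch_step psi x.
Proof.
move=> phi01 psi01; elim: n x => [|n ih] x le /=; first by apply: le; rewrite addn0.
apply: branch_step_le => [||y yF]; try exact: iter_branch_unit.
apply: ih => z zl; apply: le; apply: leq_trans zl _.
by have := LM x y; have := LK yF; lia.
Qed.

Definition farther (c : R) z : R := (c < (L z)%:R :> R)%:R.

Lemma farther_unit c : unit_valued (farther c).
Proof. by move=> z; rewrite ler0n lern1 leq_b1. Qed.

(** First moment bound for the particles close to the origin. *)
Lemma branch_first_moment n c :
  1 - iter n branch_step (farther c) 1%g <= rho ^+ n * low n c.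
Proof.
apply: le_trans (iter_branch_compl_le n 1%g (@farther_unit c)) _.
rewrite ler_wpM2l ?exprn_ge0 //.
  by case: offpi => _ _ _ /ltW /(le_trans ler01).
apply: iter_walk_step_le => // z; rewrite /farther ltNge.
by case: (_ <= c) => /=; rewrite ?subr0 ?subrr.
Qed.

(** A constant weight is mapped to the iterates of the generating function. *)
Lemma iter_branch_cst_le n (s0 s : R) x : 0 < s0 < 1 -> pgf pi s0 <= s0 ->
  0 <= s <= s0 ->
  iter n branch_step (fun=> s) x <= (pgf pi s0 / s0) ^+ n * s.
Proof.
move=> /andP[s00 s01] fs0 /andP[sge0 sle].
set th := pgf pi s0 / s0.
have th0 : 0 <= th.
  by rewrite divr_ge0 ?(pgf_ge0 offpi) ?(ltW s00) ?(ltW s01).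
have th1 : th <= 1 by rewrite ler_pdivrMr // mul1r.
have s_unit : unit_valued (fun=> s).
  by move=> z; rewrite sge0 (le_trans sle (ltW s01)).
elim: n x => [|n ih] x /=; first by rewrite mul1r.
rewrite exprS -mulrA.
have /andP[Q0 Q1] := walk_step_unit (iter_branch_unit n s_unit) x.
have Qle : Q (iter n branch_step (fun=> s)) x <= th ^+ n * s.
  rewrite -[leRHS](iter_walk_step_cst m_sum1 1 _ x) /=.
  by apply: walk_step_le => // y _; exact: ih.
have thn : th ^+ n * s <= s0.
  by apply: le_trans sle; rewrite ler_piMl // exprn_ile1.
apply: le_trans (pgf_ratio_le offpi Q0 (le_trans Qle thn) s00 (ltW s01)) _.
exact: ler_wpM2l.
Qed.

(** Keep a particle if over each of its blocks of n0 generations it has moved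
    by at most n0 y. The kept particles form a branching process, whose
    extinction probability is at most any s that the operator of one block
    does not increase. *)
Lemma branch_blocks (s y : R) n0 k c x :
  0 <= s <= 1 ->
  iter n0 branch_step (fun z => if (L z)%:R <= n0%:R * y then s else 1) 1%g <= s ->
  (L x)%:R + k%:R * (n0%:R * y) <= c ->
  iter (k * n0) branch_step (farther c) x <= s.
Proof.
move=> /andP[s0 s1] fix_s; elim: k x => [|k ih] x xc.
  by rewrite mul0n /= /farther ltNge; move: xc; rewrite mul0r addr0 => ->.
rewrite mulSn iterD.
pose psi z : R := if (L z)%:R + k%:R * (n0%:R * y) <= c then s else 1.
have psi01 : unit_valued psi by move=> z; rewrite /psi; case: ifP; rewrite ?s0 ?s1 ?ler01 /=.
apply: (@le_trans _ _ (iter n0 branch_step psi x)).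
  apply: iter_branch_le => // [|z]; first by apply: iter_branch_unit; exact: farther_unit.
  rewrite /psi; case: ifPn => [/ih //|_].
  by case/andP: (iter_branch_unit (k * n0) (@farther_unit c) z).
rewrite -[x in leLHS]mulg1 -iter_branch_translate; apply: le_trans fix_s.
apply: iter_branch_le => [z|z|z].
- exact: psi01.
- by case: ifP; rewrite ?s0 ?s1 ?ler01 /=.
rewrite /psi; case: (leP (L z)%:R) => zl; last by case: ifP.
rewrite ifT //; apply: le_trans xc.
have : (L (x * z)%g)%:R <= (L x)%:R + (L z)%:R :> R by rewrite -natrD ler_nat.
rewrite -natr1; lra.
Qed.

(** A block of n0 generations has on average more than one kept particle, so
    that the kept particles die out with a probability s < 1. After j further
    generations every particle starts an independent family, and all of them
    have to fail; since each particle has a child, the j-th iterate of the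
    generating function at s decays geometrically. *)
Lemma branch_upper_bound (y : R) n0 :
  1 < rho ^+ n0 * low n0 (n0%:R * y) ->
  exists2 th, 0 <= th < 1 &
    forall k j c, (j * K)%:R + k%:R * (n0%:R * y) <= c ->
      iter (j + k * n0) branch_step (farther c) 1%g <= th ^+ j.
Proof.
move=> super; have rho1 : 1 < rho by case: offpi.
have rho0 : 0 < rho := lt_trans ltr01 rho1.
set p := low n0 (n0%:R * y) in super.
have p0 : 0 <= p by exact: lower_tail_ge0.
(* The mean of a block stays at least 1 for some rho' slightly below rho, for
   which the linear lower bound near 1 is available. *)
have [rho' [rho'1 rho'lt rho'p]] :
    exists rho', [/\ 1 < rho', rho' < rho & 1 <= rho' ^+ n0 * p].
  have q0 : 0 < rho ^+ n0 * p by exact: lt_trans super.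
  pose e := Num.min (1 - rho^-1) ((1 - (rho ^+ n0 * p)^-1) / (n0%:R + 1)) / 2.
  have rv : 0 < 1 - rho^-1 by rewrite subr_gt0 invf_lt1.
  have qv : 0 < 1 - (rho ^+ n0 * p)^-1 by rewrite subr_gt0 invf_lt1.
  have n1 : 0 < n0%:R + 1 :> R by rewrite ltr_pwDr.
  have min0 : 0 < Num.min (1 - rho^-1) ((1 - (rho ^+ n0 * p)^-1) / (n0%:R + 1)).
    by rewrite lt_min rv divr_gt0.
  have e0 : 0 < e by rewrite divr_gt0.
  have e1 : e < 1 - rho^-1.
    have : Num.min (1 - rho^-1) ((1 - (rho ^+ n0 * p)^-1) / (n0%:R + 1)) <= 1 - rho^-1.
      by rewrite ge_min lexx.
    by move: min0; rewrite /e; lra.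
  have e2 : e * (n0%:R + 1) <= 1 - (rho ^+ n0 * p)^-1.
    rewrite -ler_pdivlMr //.
    have : Num.min (1 - rho^-1) ((1 - (rho ^+ n0 * p)^-1) / (n0%:R + 1)) <=
      (1 - (rho ^+ n0 * p)^-1) / (n0%:R + 1) by rewrite ge_min lexx orbT.
    by move: min0; rewrite /e; lra.
  have rvp : 0 < rho^-1 by rewrite invr_gt0.
  exists (rho * (1 - e)); split.
  - by rewrite mulrC -ltr_pdivrMr // div1r; lra.
  - by rewrite mulrC gtr_pMl //; lra.
  - rewrite exprMn mulrAC mulrC -ler_pdivrMr // div1r.
    have e01 : 0 <= 1 - e <= 1 by apply/andP; split; lra.
    by have := bernoulli_le n0 e01; lra.
have [a0 /andP[a0p a01] lin] := pgf_compl_ge offpi rho'lt.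
(* By the union bound, weights 1 - a stay above 1 - a0 over a whole block. *)
pose a := a0 / (2 * rho ^+ n0).
have rn0 : 1 <= rho ^+ n0 by rewrite exprn_ege1 // ltW.
have d0 : 0 < 2 * rho ^+ n0 by lra.
have ap : 0 < a by rewrite divr_gt0.
have aE : rho ^+ n0 * a = a0 / 2 by rewrite /a; field; rewrite gt_eqF //; lra.
have aa0 : rho ^+ n0 * a <= a0 by rewrite aE; lra.
have aa0' : a <= a0 / 2 by rewrite -aE ler_peMl // ltW.
pose s := 1 - a.
have s01 : 0 < s < 1 by rewrite /s; apply/andP; split; lra.
have /andP[sp s1] := s01.
have fs : pgf pi s < s.
  have aab : 0 <= a <= a0 by apply/andP; split; lra.
  have := lin a aab; rewrite -/s => h.
  have : a < rho' * a by rewrite ltr_pMl.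
  rewrite /s in h *; lra.
pose chi z : R := if (L z)%:R <= n0%:R * y then s else 1.
have fix_s : iter n0 branch_step chi 1%g <= s.
  suff : a <= 1 - iter n0 branch_step chi 1%g by rewrite /s; lra.
  have chi01 : unit_valued chi.
    by move=> z; rewrite /chi; case: ifP; rewrite ?ler01 ?lexx ?(ltW sp) ?(ltW s1).
  apply: le_trans (@iter_branch_compl_ge rho' n0 a0 a _ _ _ lin (ltW ap) aa0 chi01 _); last 2 first.
  - by rewrite (le_trans ler01) // ltW.
  - by move=> z; rewrite /chi /s; case: ifP => _; lra.
  have -> : (fun z => 1 - chi z) = (fun z => a * ((L z)%:R <= n0%:R * y :> R)%:R).
    apply/funext => z; rewrite /chi /s; case: ifP => _; first by rewrite mulr1; lra.
    by rewrite mulr0 subrr.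
  rewrite iter_walk_step_scale // mulrCA ler_peMr //; exact: ltW.
exists (pgf pi s / s).
  by rewrite divr_ge0 ?ltr_pdivrMr ?mul1r ?(pgf_ge0 offpi) ?(ltW sp) ?(ltW s1).
move=> k j c jc; rewrite iterD.
apply: (@le_trans _ _ (iter j branch_step (fun=> s) 1%g)).
  apply: iter_branch_le_ball => [|z|z].
  - by apply: iter_branch_unit; exact: farther_unit.
  - by rewrite (ltW sp) (ltW s1).
  rewrite L1 add0n => zl; apply: branch_blocks fix_s _; first by rewrite (ltW sp) (ltW s1).
  by apply: le_trans jc; rewrite lerD2r ler_nat.
have th0 : 0 <= pgf pi s / s.
  by rewrite divr_ge0 ?(pgf_ge0 offpi) ?(ltW sp) ?(ltW s1).
apply: le_trans (iter_branch_cst_le _ _ s01 (ltW fs) _) _.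
  by rewrite (ltW sp) lexx.
by rewrite ler_piMr ?exprn_ge0 // ltW.
Qed.

End Branching.

(** * Law of the branching random walk *)

Section Cells.
Context (R : realType) d (T : measurableType d) (P : probability T R).
Context (J : choiceType) (s : seq J) (A : nat -> J -> set T).
Hypothesis us : uniq s.
Hypothesis mA : forall c y, y \in s -> measurable (A c y).
Hypothesis dA : forall c y c' y' w, A c y w -> A c' y' w -> c = c' /\ y = y'.

Lemma measure_cells :
  (P (\bigcup_c \bigcup_(y in [set` s]) A c y) =
   \sum_(y <- s) \sum_(0 <= c <oo) P (A c y))%E.
Proof.
rewrite measure_bigcup; last 2 first.
- move=> c _; apply: fin_bigcup_measurable => [|y ys]; last exact: mA.
  exact: finite_seq.
- by move=> c c' _ _ [w [[y _ Ay] [y' _ Ay']]]; case: (dA Ay Ay').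
rewrite (@eq_eseriesl _ _ xpredT) => [|c]; last by rewrite in_setT.
rewrite -nneseries_sum //; apply: eq_eseriesr => c _.
rewrite measure_fin_bigcup.
- by rewrite [RHS]fsbig_seq.
- exact: finite_seq.
- by move=> y y' _ _ [w [Ay Ay']]; case: (dA Ay Ay').
- by move=> y; exact: mA.
Qed.

(** Disjoint cells that exhaust the probability of C decompose every event
    contained in C, since what they leave out is negligible. *)
Lemma measure_cells_split (C H : set T) :
  measurable C -> measurable (C `&` H) -> (forall c y, A c y `<=` C) ->
  (P C = \sum_(y <- s) \sum_(0 <= c <oo) P (A c y))%E ->
  P (C `&` H) = P ((C `&` H) `&` \bigcup_c \bigcup_(y in [set` s]) A c y).
Proof.
move=> mC mH AC PC.
set U := \bigcup_c _.
have mU : measurable U.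
  apply: bigcup_measurable => c _; apply: fin_bigcup_measurable => [|y ys].
    exact: finite_seq.
  exact: mA.
have UC : U `<=` C by move=> w [c _ [y _ /AC]].
have PU : P U = P C by rewrite PC -measure_cells.
have CU : P (C `\` U) = 0%E.
  have CU : C `&` U = U by apply/seteqP; split=> [w []|w Uw] //; split=> //; exact: UC.
  have PC0 : (P C - P U = 0)%E by rewrite PU subee // fin_num_measure.
  by rewrite measureD ?ltey_eq ?fin_num_measure // CU.
have null : P ((C `&` H) `\` U) = 0%E.
  apply: (subset_measure0 _ _ _ CU); try exact: measurableD.
  by move=> w [[Cw _] nU].
rewrite (measureDI P mH mU) -[RHS]add0e; congr (_ + _)%E; exact: null.
Qed.

End Cells.

Section TreeLaw.
Context (R : realType) (r : nat) (gT : 'I_r -> finGroupType).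
Context d (Omega : measurableType d) (P : probability Omega R).
Context (pi : nat -> R) (rho : R) (m : freeprod gT -> R).
Context (N : vertex -> Omega -> nat) (zeta : vertex -> Omega -> freeprod gT).
Context (F : seq (freeprod gT)).
Hypotheses (offpi : offspring_law pi rho) (uF : uniq F).
Hypotheses (m_ge0 : forall y, 0 <= m y) (m_sum1 : \sum_(y <- F) m y = 1).
Hypothesis brw : branching_random_walk P pi m N zeta.
Local Notation G := (freeprod gT).

Lemma freeprod_countable : countable [set: G].
Proof. exact: (countableP [set: {w : seq (letter gT) | is_reduced w}]). Qed.

Lemma gw_tree_rcons w u i :
  gw_tree N w (rcons u i) <-> gw_tree N w u /\ (i < N u w)%N.
Proof.
rewrite /gw_tree /= size_rcons; split=> [h|[h hi] k].
  split=> [k ku|]; last first.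
    by have := h (size u) (ltnSn _); rewrite nth_rcons ltnn eqxx -cats1 take_size_cat.
  have := h k (ltnW ku); rewrite nth_rcons ku -cats1 takel_cat //; exact: ltnW.
rewrite ltnS leq_eqVlt nth_rcons => /orP[/eqP ->|ku].
  by rewrite ltnn eqxx -cats1 take_size_cat.
by rewrite ku -cats1 takel_cat ?h // ltnW.
Qed.

Lemma gw_tree_catl w u v : gw_tree N w (u ++ v) -> gw_tree N w u.
Proof.
elim/last_ind: v => [|v i ih]; first by rewrite cats0.
by rewrite -rcons_cat => /gw_tree_rcons[/ih].
Qed.

Lemma measurable_offspring v (A : set nat) : measurable [set w | A (N v w)].
Proof.
have [[mN _] _] := brw.
rewrite (_ : [set w | _] = \bigcup_(k in A) [set w | N v w = k]).
  by apply: bigcup_measurable => k _; exact: mN.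
by apply/seteqP; split=> [w Aw|w [k Ak] /= ->] //; exists (N v w).
Qed.

Lemma measurable_gw_tree v : measurable [set w | gw_tree N w v].
Proof.
elim/last_ind: v => [|v i ih].
  by rewrite (_ : [set w | _] = setT) //; apply/seteqP; split.
rewrite (_ : [set w | _] = [set w | gw_tree N w v] `&` [set w | (i < N v w)%N]).
  by apply: measurableI => //; exact: (measurable_offspring v [set k | (i < k)%N]).
by apply/seteqP; split=> w /gw_tree_rcons.
Qed.

Lemma measurable_all_seq d' (T : measurableType d') (I : eqType) (s : seq I)
    (A : I -> T -> Prop) :
  (forall v, v \in s -> measurable [set w | A v w]) ->
  measurable [set w | forall v, v \in s -> A v w].
Proof.
elim: s => [|v s ih] mA.
  by rewrite (_ : [set w | _] = setT) //; apply/seteqP; split.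
rewrite (_ : [set w | _] = [set w | A v w] `&` [set w | forall v, v \in s -> A v w]).
  apply: measurableI; first by apply: mA; rewrite mem_head.
  by apply: ih => u us; apply: mA; rewrite inE us orbT.
apply/seteqP; split=> w => [h|[h1 h2] u].
  by split=> [|u us]; apply: h; rewrite inE ?eqxx ?us ?orbT.
by rewrite inE => /predU1P[->|/h2].
Qed.

(** An exploration records the offspring numbers and displacements of a set of
    vertices; it is carried out from the root, so that it decides by itself
    which of the recorded vertices belong to the tree. *)
Definition reached (s : seq vertex) (k : vertex -> nat) (v : vertex) : Prop :=
  forall j, (j < size v)%N -> take j v \in s /\ (nth 0%N v j < k (take j v))%N.

Definition explored (s : seq vertex) (k : vertex -> nat) : Prop :=
  uniq s /\ forall v, v \in s -> reached s k v.

Definition record (s : seq vertex) (k : vertex -> nat) (x : vertex -> G) : set Omega :=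
  [set w | forall v, v \in s -> N v w = k v /\ zeta v w = x v].

Definition weight (s : seq vertex) (k : vertex -> nat) (x : vertex -> G) : R :=
  \prod_(v <- s) (pi (k v) * m (x v)).

Lemma reached_tree s k w v :
  (forall u, u \in s -> N u w = k u) -> reached s k v -> gw_tree N w v.
Proof. by move=> Nk rv j jv; have [vs lt] := rv j jv; rewrite (Nk _ vs). Qed.

Lemma record_tree s k x w v : record s k x w -> reached s k v -> gw_tree N w v.
Proof. by move=> rw; apply: reached_tree => u /rw[]. Qed.

(** The offspring number of a vertex of the tree is determined by which of its
    children are in the tree. *)
Lemma sigma_tree_offspring v c : sigma_tree N [set w | gw_tree N w v /\ N v w = c].
Proof.
pose T := g_sigma_algebraType [set A | exists v, A = [set w | gw_tree N w v]].
have mT u : measurable ([set w | gw_tree N w u] : set T).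
  by apply: sub_sigma_algebra; exists u.
suff : measurable ([set w | gw_tree N w v /\ N v w = c] : set T) by [].
have below k : measurable ([set w | gw_tree N w v /\ (k <= N v w)%N] : set T).
  case: k => [|k].
    by rewrite (_ : [set w | _] = [set w | gw_tree N w v]) //; apply/seteqP; split=> w // [].
  rewrite (_ : [set w | _] = [set w | gw_tree N w (rcons v k)]) //.
  by apply/seteqP; split=> w /gw_tree_rcons.
rewrite (_ : [set w | _] = [set w | gw_tree N w v /\ (c <= N v w)%N] `\`
    [set w | gw_tree N w v /\ (c.+1 <= N v w)%N]); first exact: measurableD.
apply/seteqP; split=> w => [[tv <-]|[[tv le] nlt]].
  by split=> // -[_]; rewrite ltnn.
split=> //; apply/eqP; rewrite eqn_leq le andbT leqNgt.
by apply/negP => lt; apply: nlt.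
Qed.

Lemma measurable_displacement v (A : set G) :
  measurable [set w | gw_tree N w v /\ A (zeta v w)].
Proof.
have [_ [mz _]] := brw.
rewrite (_ : [set w | _] = \bigcup_(y : G)
   (if `[< A y >] then [set w | gw_tree N w v /\ zeta v w = y] else set0)).
  apply: (countable_bigcupT_measurable freeprod_countable) => y.
  by case: ifP.
apply/seteqP; split=> w => [[tv Az]|[y _]].
  by exists (zeta v w) => //; rewrite asboolT.
by case: asboolP => //= Ay [tv ->].
Qed.

Lemma measurable_record s k x : explored s k -> measurable (record s k x).
Proof.
move=> [us es].
rewrite (_ : record s k x = [set w | forall v, v \in s ->
   (gw_tree N w v /\ zeta v w = x v) /\ N v w = k v]).
  apply: measurable_all_seq => v vs; apply: measurableI.
    exact: (measurable_displacement v [set x v]).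
  exact: (measurable_offspring v [set k v]).
apply/seteqP; split=> w rw v vs; last by have [[]] := rw v vs.
have [Nv zv] := rw v vs; do 2!split=> //.
exact: record_tree rw (es v vs).
Qed.

(** An exploration describes an event of the tree on which its vertices are
    present, so that the law of the displacements given the tree applies. *)
Lemma record_prob s k x : explored s k -> P (record s k x) = (weight s k x)%:E.
Proof.
move=> [us es]; have [[mN PN] [mz Pz]] := brw.
pose A := [set w | forall v, v \in s -> N v w = k v].
have At : A `<=` [set w | forall v, v \in s -> gw_tree N w v].
  by move=> w Aw v vs; apply: reached_tree Aw (es v vs).
have sA : sigma_tree N A.
  rewrite (_ : A = [set w | forall v, v \in s -> gw_tree N w v /\ N v w = k v]).
    pose T := g_sigma_algebraType [set A | exists v, A = [set w | gw_tree N w v]].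
    apply: (@measurable_all_seq _ T _ s (fun v w => gw_tree N w v /\ N v w = k v)).
    by move=> v _; exact: sigma_tree_offspring.
  apply/seteqP; split=> w Aw v vs; last by have [] := Aw v vs.
  by split; [exact: At|exact: Aw].
have := Pz s x A us sA At; rewrite PN // -EFinM -big_split /= => <-.
congr (P _); apply/seteqP; split=> w => [rw|[h1 h2] v vs].
  by split=> v /rw[].
by split; [exact: h1|exact: h2].
Qed.

Definition upd (V : Type) (f : vertex -> V) (u : vertex) (c : V) : vertex -> V :=
  fun v => if v == u then c else f v.

Lemma reached_upd s k u c v :
  u \notin s -> reached s k v -> reached (u :: s) (upd k u c) v.
Proof.
move=> us rv j jv; have [vs lt] := rv j jv; rewrite inE vs orbT; split=> //.
by rewrite /upd ifN //; apply: contraNneq us => <-.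
Qed.

Lemma explored_upd s k u c : explored s k -> u \notin s -> reached s k u ->
  explored (u :: s) (upd k u c).
Proof.
move=> [us es] nu ru; split=> /=; first by rewrite nu.
by move=> v; rewrite inE => /predU1P[->|/es rv]; apply: reached_upd.
Qed.

Lemma weight_upd s k x u c y : u \notin s ->
  weight (u :: s) (upd k u c) (upd x u y) = pi c * m y * weight s k x.
Proof.
move=> us; rewrite /weight big_cons /upd eqxx; congr (_ * _).
rewrite big_seq [RHS]big_seq; apply: eq_bigr => v vs.
have /negPf -> // : v != u by apply: contraNneq us => <-.
Qed.

Lemma record_upd s k x u c y : u \notin s ->
  record (u :: s) (upd k u c) (upd x u y) =
  record s k x `&` [set w | N u w = c /\ zeta u w = y].
Proof.
move=> us; apply/seteqP; split=> w => [rw|[rw [Nu zu]] v].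
  split=> [v vs|]; last by have := rw u (mem_head _ _); rewrite /upd eqxx.
  have /negPf vu : v != u by apply: contraNneq us => <-.
  by have := rw v; rewrite inE vs orbT /upd vu; exact.
rewrite inE /upd; case: eqVneq => [-> _|vu /= /rw //]; by split.
Qed.

(** Exploring one more vertex: if, whatever is found there, the conditional
    probability of H is [a y * b y ^+ c], then averaging over the offspring
    number c brings in the generating function at [b y]. *)
Lemma explore_vertex s k x u (H : set Omega) (a b : G -> R) :
  explored s k -> u \notin s -> reached s k u ->
  measurable (record s k x `&` H) ->
  (forall y, 0 <= a y) -> (forall y, 0 <= b y <= 1) ->
  (forall c y, P (record (u :: s) (upd k u c) (upd x u y) `&` H) =
     (a y * b y ^+ c * weight (u :: s) (upd k u c) (upd x u y))%:E) ->
  P (record s k x `&` H) =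
  ((\sum_(y <- F) m y * (a y * pgf pi (b y))) * weight s k x)%:E.
Proof.
move=> es us ru mH a0 b01 PH.
have [pi_ge0 _ _ _ _] := offpi.
have w0 : 0 <= weight s k x by apply: prodr_ge0 => v _; rewrite mulr_ge0.
have sumE (a' b' : G -> R) : (forall y, 0 <= a' y) -> (forall y, 0 <= b' y <= 1) ->
    (\sum_(y <- F) \sum_(0 <= c <oo)
      (a' y * b' y ^+ c * weight (u :: s) (upd k u c) (upd x u y))%:E =
    ((\sum_(y <- F) m y * (a' y * pgf pi (b' y))) * weight s k x)%:E)%E.
  move=> a'0 b'01; rewrite mulr_suml -sumEFin; apply: eq_bigr => y _.
  rewrite (eq_eseriesr (g := fun c =>
    ((m y * a' y * weight s k x)%:E * (pi c * b' y ^+ c)%:E)%E)); last first.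
    by move=> c _; rewrite weight_upd // -EFinM; congr EFin; ring.
  rewrite nneseriesZl; last first.
    by move=> c _; rewrite lee_fin mulr_ge0 ?exprn_ge0 //; case/andP: (b'01 y).
  by rewrite -(pgf_series offpi) // -EFinM; congr EFin; ring.
pose A c y := record (u :: s) (upd k u c) (upd x u y).
have mA c y : y \in F -> measurable (A c y).
  by move=> _; apply: measurable_record; exact: explored_upd.
have dA c y c' y' w : A c y w -> A c' y' w -> c = c' /\ y = y'.
  by rewrite /A !record_upd // => -[_ [<- <-]] [_ [<- <-]].
have AC c y : A c y `<=` record s k x by rewrite /A record_upd // => w [].
have PA c y : P (A c y) = (weight (u :: s) (upd k u c) (upd x u y))%:E.
  by apply: record_prob; exact: explored_upd.
rewrite (measure_cells_split uF mA dA (measurable_record x es) mH AC); last first.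
  rewrite record_prob // -[weight s k x]mul1r.
  have <- : \sum_(y <- F) m y * (1 * pgf pi 1) = 1.
    by rewrite (pgf1 offpi) -mulr_suml m_sum1 !mul1r.
  rewrite -(sumE (fun=> 1) (fun=> 1)) => [|//|y]; last by rewrite ler01 lexx.
  apply: eq_bigr => y _; apply: eq_eseriesr => c _.
  by rewrite PA expr1n !mul1r.
rewrite setI_bigcupr; under eq_bigcupr do rewrite setI_bigcupr.
rewrite (@measure_cells _ _ _ _ _ _ (fun c y => record s k x `&` H `&` A c y) uF); last 2 first.
- by move=> c y yF; apply: measurableI => //; exact: mA.
- by move=> c y c' y' w [_ +] [_]; exact: dA.
rewrite -sumE //; apply: eq_bigr => y _; apply: eq_eseriesr => c _.
rewrite -PH; congr (P _); apply/seteqP; split=> w => [[[_ Hw] Aw] //|[Aw Hw]].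
by do 2!split=> //; exact: AC Aw.
Qed.

Section Descendants.
Context (B : G -> bool).

(** [descend n u g w]: every vertex of the tree n generations below u has its
    position in B, when u itself is placed at g. *)
Fixpoint descend n u g w : Prop :=
  if n is n'.+1 then
    forall i, gw_tree N w (rcons u i) -> descend n' (rcons u i) (g * zeta (rcons u i) w)%g w
  else B g.

(** A pending vertex comes with the position of its parent, its own
    displacement being still unknown. *)
Definition pending n (ts : seq (vertex * G)) w : Prop :=
  forall t, t \in ts -> descend n t.1 (t.2 * zeta t.1 w)%g w.

Definition kids u c (g : G) : seq (vertex * G) := [seq (rcons u i, g) | i <- iota 0 c].

Lemma descend_kids n u g w : gw_tree N w u ->
  descend n.+1 u g w <-> pending n (kids u (N u w) g) w.
Proof.
move=> tu /=; split=> [h t /mapP[i]|h i /gw_tree_rcons[_ iN]].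
  by rewrite mem_iota => iN -> /=; apply: h; apply/gw_tree_rcons.
by apply: (h (rcons u i, g)); apply/mapP; exists i => //; rewrite mem_iota.
Qed.

Lemma measurable_descend n u g :
  measurable [set w | descend n u g w] /\
  measurable [set w | gw_tree N w u /\ descend n u (g * zeta u w)%g w].
Proof.
have split_zeta k : (forall g, measurable [set w | descend k u g w]) ->
    measurable [set w | gw_tree N w u /\ descend k u (g * zeta u w)%g w].
  move=> mk; rewrite (_ : [set w | _] = \bigcup_(y : G)
     ([set w | gw_tree N w u /\ zeta u w = y] `&` [set w | descend k u (g * y)%g w])).
    apply: (countable_bigcupT_measurable freeprod_countable) => y.
    by apply: measurableI => //; have [_ [mz _]] := brw; exact: mz.
  apply/seteqP; split=> w => [[tu du]|[y _ [[tu <-] du]]] //.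
  by exists (zeta u w).
suff md k v h : measurable [set w | descend k v h w].
  by split; [exact: md|exact: split_zeta].
elim: k v h {split_zeta u g} => [|k ih] v h /=.
  case: (B h); last by rewrite (_ : [set w | _] = set0) //; apply/seteqP; split.
  by rewrite (_ : [set w | _] = setT) //; apply/seteqP; split.
rewrite (_ : [set w | _] = \bigcap_i
  (~` [set w | gw_tree N w (rcons v i)] `|` \bigcup_(y : G)
     ([set w | gw_tree N w (rcons v i) /\ zeta (rcons v i) w = y] `&`
      [set w | descend k (rcons v i) (h * y)%g w]))).
  apply: bigcap_measurable => [|i _]; first by exists 0%N.
  apply: measurableU; first by apply: measurableC; exact: measurable_gw_tree.
  apply: (countable_bigcupT_measurable freeprod_countable) => y.
  by apply: measurableI => //; have [_ [mz _]] := brw; exact: mz.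
apply/seteqP; split=> w => [hw i _|hw i ti].
  have [ti|nti] := pselect (gw_tree N w (rcons v i)); last by left.
  by right; exists (zeta (rcons v i) w) => //; split=> //; exact: hw.
by have [//|[y _ [[_ <-] dk]]] := hw i I.
Qed.

Lemma measurable_pending n s k x ts : explored s k ->
  (forall t, t \in ts -> reached s k t.1) ->
  measurable (record s k x `&` [set w | pending n ts w]).
Proof.
move=> es rts.
rewrite (_ : _ `&` _ = record s k x `&` [set w | forall t, t \in ts ->
    gw_tree N w t.1 /\ descend n t.1 (t.2 * zeta t.1 w)%g w]).
  apply: measurableI; first exact: measurable_record.
  by apply: measurable_all_seq => t _; case: (measurable_descend n t.1 t.2).
apply/seteqP; split=> w [rw h]; split=> // t tt; last by have [] := h t tt.
split; last exact: h.
exact: record_tree rw (rts t tt).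
Qed.

Lemma pending_cat n ts ts' w : pending n (ts ++ ts') w <-> pending n ts w /\ pending n ts' w.
Proof.
split=> [h|[h1 h2] t]; last by rewrite mem_cat => /orP[/h1|/h2].
by split=> t tt; apply: h; rewrite mem_cat tt ?orbT.
Qed.

Lemma pending_cons n t ts w : pending n (t :: ts) w <->
  descend n t.1 (t.2 * zeta t.1 w)%g w /\ pending n ts w.
Proof.
split=> [h|[h1 h2] t']; last by rewrite inE => /predU1P[->|/h2].
by split=> [|t' tt]; apply: h; rewrite inE ?eqxx ?tt ?orbT.
Qed.

Definition frontier s k (ts : seq (vertex * G)) : Prop :=
  uniq [seq t.1 | t <- ts] /\
  forall t, t \in ts -> t.1 \notin s /\ reached s k t.1.

(** An explored set contains the parents of its vertices, so that the children
    of a new vertex are unexplored. *)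
Lemma kids_frontier s k u c g g' ts : explored s k ->
  frontier s k ((u, g) :: ts) ->
  frontier (u :: s) (upd k u c) (kids u c g' ++ ts).
Proof.
move=> [us es] [/= /andP[uts uniq_ts] fr].
have [nu ru] := fr (u, g) (mem_head _ _); rewrite /= in nu ru.
have notkid v i : reached s k v -> v != rcons u i.
  move=> rv; apply: contraNneq nu => ev.
  have := rv (size u); rewrite ev size_rcons ltnSn -cats1 take_size_cat //.
  by case.
have fr' t : t \in ts -> t.1 \notin s /\ reached s k t.1.
  by move=> tt; apply: fr; rewrite inE tt orbT.
split.
  rewrite map_cat cat_uniq uniq_ts andbT; apply/andP; split.
    rewrite -map_comp map_inj_uniq ?iota_uniq // => i j /= /eqP.
    by rewrite eqseq_rcons => /andP[_ /eqP].
  apply/hasPn => v /mapP[t tt ->]; apply/negP; rewrite -map_comp => /mapP[i _ /= e].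
  by have := notkid t.1 i (fr' t tt).2; rewrite e eqxx.
move=> t; rewrite mem_cat => /orP[/mapP[i]|tt]; last first.
  have [nt rt] := fr' t tt; split; last exact: reached_upd.
  rewrite inE negb_or nt andbT; apply: contraNneq uts => <-.
  by apply/mapP; exists t.
rewrite mem_iota /= add0n => ic -> /=; split.
  rewrite inE negb_or; apply/andP; split.
    by apply/eqP => /(congr1 size); rewrite size_rcons; lia.
  by apply/negP => /es /(notkid _ i); rewrite eqxx.
move=> j; rewrite size_rcons ltnS leq_eqVlt nth_rcons => /orP[/eqP ->|ju].
  by rewrite ltnn eqxx -cats1 take_size_cat // mem_head /upd eqxx.
have [ts' lt] := ru j ju.
rewrite ju -cats1 takel_cat ?(ltnW ju) // inE ts' orbT; split=> //.
by rewrite /upd ifN //; apply: contraNneq nu => <-.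
Qed.

Definition bweight : G -> R := fun g => (B g)%:R.

(** The probability that [descend n u] holds when the parent of u is at g. *)
Definition value n g : R := walk_step F m (iter n (branch_step pi F m) bweight) g.

Lemma bweight_unit : unit_valued bweight.
Proof. by move=> g; rewrite ler0n lern1 leq_b1. Qed.

Lemma value_unit n g : 0 <= value n g <= 1.
Proof.
by apply: walk_step_unit => //; apply: (iter_branch_unit offpi) => //; exact: bweight_unit.
Qed.

Lemma valueS n g : value n.+1 g = \sum_(y <- F) m y * pgf pi (value n (g * y)%g).
Proof. by []. Qed.

Lemma prod_value_ge0 n (ts : seq (vertex * G)) : 0 <= \prod_(t <- ts) value n t.2.
Proof. by apply: prodr_ge0 => t _; case/andP: (value_unit n t.2). Qed.

Lemma prod_kids n u c g : \prod_(t <- kids u c g) value n t.2 = value n g ^+ c.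
Proof.
by rewrite /kids big_map /= big_const_seq count_predT size_iota iter_mulr_1.
Qed.

Lemma frontier_catr s k ts ts' : frontier s k (ts ++ ts') -> frontier s k ts'.
Proof.
move=> [+ fr]; rewrite map_cat cat_uniq => /and3P[_ _ uts]; split=> // t tt.
by apply: fr; rewrite mem_cat tt orbT.
Qed.

Lemma frontier_perm s k ts ts' : perm_eq ts ts' -> frontier s k ts -> frontier s k ts'.
Proof.
move=> pe [uts fr]; split=> [|t]; last by rewrite -(perm_mem pe); exact: fr.
by rewrite -(perm_uniq (perm_map _ pe)).
Qed.

Lemma pending_prob0 s k x ts : explored s k -> frontier s k ts ->
  P (record s k x `&` [set w | pending 0 ts w]) =
  ((\prod_(t <- ts) value 0 t.2) * weight s k x)%:E.
Proof.
elim: ts s k x => [|[u g] ts ih] s k x es fr.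
  rewrite big_nil mul1r (_ : _ `&` _ = record s k x) ?record_prob //.
  by apply/seteqP; split=> [w []|w rw].
have [nu ru] := fr.2 (u, g) (mem_head _ _); rewrite /= in nu ru.
pose a y : R := bweight (g * y)%g * \prod_(t <- ts) value 0 t.2.
rewrite (@explore_vertex s k x u _ a (fun=> 1)) //.
- rewrite big_cons [value 0 (_, _).2]/value /= /walk_step (pgf1 offpi).
  by rewrite mulr_suml; congr ((_ * _)%:E); apply: eq_bigr => y _; rewrite /a mulr1 mulrA.
- by apply: measurable_pending => // t /fr.2[].
- by move=> y; rewrite mulr_ge0 // ?prod_value_ge0 // ler0n.
- by move=> y; rewrite ler01 lexx.
move=> c y; rewrite expr1n mulr1 /a.
have es' := explored_upd c es nu ru.
have fr' := frontier_catr (kids_frontier c (g * y)%g es fr).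
rewrite -mulrA EFinM -ih //.
have zu w : record (u :: s) (upd k u c) (upd x u y) w -> zeta u w = y.
  by rewrite record_upd // => -[_ []].
rewrite /bweight; case: (boolP (B (g * y)%g)) => By; last first.
  rewrite mul0e (_ : _ `&` _ = set0) ?measure0 //.
  apply/seteqP; split=> // w [/zu zw /pending_cons[]] /=.
  by rewrite zw => Bw; move: By; rewrite Bw.
rewrite mul1e; congr (P _); apply/seteqP; split=> w [rw pw]; split=> //.
  by have [] := (pending_cons 0 (u, g) ts w).1 pw.
by apply/pending_cons; split=> //=; rewrite (zu w rw).
Qed.

(** The branching property: families of distinct pending vertices are
    independent of each other and of what has been explored. *)
Lemma pending_prob n s k x ts : explored s k -> frontier s k ts ->
  P (record s k x `&` [set w | pending n ts w]) =
  ((\prod_(t <- ts) value n t.2) * weight s k x)%:E.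
Proof.
elim: n s k x ts => [|n ih] s k x ts; first exact: pending_prob0.
(* The children met while the vertices of ts are explored one by one pile up in
   a second list. *)
suff gen ts1 ts2 : explored s k -> frontier s k (ts1 ++ ts2) ->
  P (record s k x `&` [set w | pending n.+1 ts1 w /\ pending n ts2 w]) =
  ((\prod_(t <- ts1) value n.+1 t.2 * \prod_(t <- ts2) value n t.2) * weight s k x)%:E.
  move=> es fr; have := gen ts [::] es; rewrite cats0 big_nil mulr1 => /(_ fr) <-.
  by congr (P _); apply/seteqP; split=> w [rw]; [|case].
elim: ts1 s k x ts2 {ts} => [|[u g] ts1 ih1] s k x ts2 es fr.
  rewrite big_nil mul1r -ih //; congr (P _).
  by apply/seteqP; split=> w [rw]; [case|].
have [nu ru] := fr.2 (u, g) (mem_head _ _); rewrite /= in nu ru.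
pose a (y : G) : R := \prod_(t <- ts1) value n.+1 t.2 * \prod_(t <- ts2) value n t.2.
rewrite (@explore_vertex s k x u _ a (fun y => value n (g * y)%g)) //.
- rewrite big_cons; congr ((_ * _)%:E).
  rewrite -mulrA valueS mulr_suml; apply: eq_bigr => y _.
  by rewrite /a; ring.
- rewrite (_ : _ `&` _ = (record s k x `&` [set w | pending n.+1 ((u, g) :: ts1) w]) `&`
    (record s k x `&` [set w | pending n ts2 w])).
    by apply: measurableI; apply: measurable_pending => // t tt;
      have [] := fr.2 t; rewrite // mem_cat tt ?orbT.
  apply/seteqP; split=> [w [rw [p1 p2]]|w [[rw p1] [_ p2]]].
    exact: (conj (conj rw p1) (conj rw p2)).
  exact: (conj rw (conj p1 p2)).
- by move=> y; rewrite mulr_ge0 // prod_value_ge0.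
- by move=> y; exact: value_unit.
move=> c y.
have es' := explored_upd c es nu ru.
have fr' := frontier_perm (permEl (perm_catCA _ _ _)) (kids_frontier c (g * y)%g es fr).
set rec := record (u :: s) (upd k u c) (upd x u y).
rewrite (_ : rec `&` _ = rec `&` [set w | pending n.+1 ts1 w /\
   pending n (kids u c (g * y)%g ++ ts2) w]).
  rewrite ih1 // big_cat prod_kids /a /=; congr (EFin _); ring.
have rec_u w : rec w -> [/\ gw_tree N w u, N u w = c & zeta u w = y].
  rewrite /rec record_upd // => -[rw [Nu zu]]; split=> //.
  exact: record_tree rw ru.
apply/seteqP; split=> w [rw [p1 p2]]; have [tu Nu zu] := rec_u w rw; split=> //.
  have [d1 p1'] := (pending_cons n.+1 (u, g) ts1 w).1 p1; split=> //.
  apply/pending_cat; split=> //.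
  by rewrite -Nu; apply/descend_kids => //; rewrite -zu.
have [pk p2'] := (pending_cat n _ _ w).1 p2; split=> //.
apply/pending_cons; split=> //; rewrite /= zu.
by apply/(descend_kids n (g * y)%g tu); rewrite Nu.
Qed.

Lemma descend_prob n :
  P [set w | descend n [::] 1%g w] = (iter n (branch_step pi F m) bweight 1%g)%:E.
Proof.
case: n => [|n].
  rewrite /= /bweight; case: (B 1%g).
    by rewrite (_ : [set w | _] = setT) ?probability_setT //; apply/seteqP; split.
  by rewrite (_ : [set w | _] = set0) ?measure0 //; apply/seteqP; split.
pose k : vertex -> nat := fun=> 0%N; pose x : vertex -> G := fun=> 1%g.
have es : explored [::] k by [].
have ru : reached [::] k [::] by [].
have all0 : record [::] k x = setT by apply/seteqP; split.
rewrite -[X in P X]setTI -all0.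
rewrite (@explore_vertex [::] k x [::] _ (fun=> 1) (fun=> value n 1%g)) //.
- rewrite /weight big_nil mulr1 -mulr_suml m_sum1 !mul1r.
  by rewrite /= -/(branch_step pi F m) {1}/branch_step /value.
- by rewrite all0 setTI; case: (measurable_descend n.+1 [::] 1%g).
- by move=> y; exact: value_unit.
move=> c y.
have es' : explored [:: [::]] (upd k [::] c) by exact: explored_upd.
have fr' : frontier [:: [::]] (upd k [::] c) (kids [::] c 1%g).
  by rewrite -[kids _ _ _]cats0; apply: (@kids_frontier [::] k [::] c 1%g); split=> // t; rewrite inE => /eqP ->.
rewrite mul1r -(prod_kids n [::] c 1%g) -pending_prob //; congr (P _).
apply/seteqP; split=> w [rw h]; split=> //;
  have Nr : N [::] w = c by have [] := rw [::] (mem_head _ _).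
- by rewrite -Nr; apply/descend_kids.
- by apply/descend_kids => //; rewrite Nr.
Qed.

Lemma descend_position n u g w : gw_tree N w u ->
  descend n u g w <->
  forall v, gw_tree N w (u ++ v) -> size v = n ->
    B (g * \prod_(k < n) zeta (u ++ take k.+1 v) w)%g.
Proof.
elim: n u g => [|n ih] u g tu /=.
  split=> [Bg v _ _|h]; first by rewrite big_ord0 mulg1.
  by have := h [::]; rewrite cats0 big_ord0 mulg1; exact.
have shift i v : (\prod_(k < n.+1) zeta (u ++ take k.+1 (i :: v)) w =
    zeta (rcons u i) w * \prod_(k < n) zeta (rcons u i ++ take k.+1 v) w)%g.
  rewrite big_ord_recl /= take0 cats1; congr (_ * _)%g.
  by apply: eq_bigr => k _; rewrite cat_rcons.
split=> [h [//|i v] tv [sv]|h i ti].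
  rewrite shift mulgA; have tv' : gw_tree N w (rcons u i ++ v) by rewrite cat_rcons.
  have ti := gw_tree_catl tv'.
  exact: (ih _ _ ti).1 (h i ti) v tv' sv.
apply/(ih _ _ ti) => v tv sv; rewrite -mulgA -shift; apply: h => /=.
  by rewrite -cat_rcons.
by rewrite sv.
Qed.

Definition all_in n : set Omega :=
  [set w | forall v, gw_tree N w v -> size v = n -> B (position zeta v w)].

Lemma all_inE n : all_in n = [set w | descend n [::] 1%g w].
Proof.
have t0 w : gw_tree N w [::] by [].
apply/seteqP; split=> w /= h.
  apply/(descend_position n _ (t0 w)) => v tv sv; rewrite mul1g.
  by have := h v tv sv; rewrite /position sv.
move=> v tv sv; have := (descend_position n 1%g (t0 w)).1 h v tv sv.
by rewrite mul1g /position sv.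
Qed.

Lemma measurable_all_in n : measurable (all_in n).
Proof. by rewrite all_inE; case: (measurable_descend n [::] 1%g). Qed.

Lemma all_in_prob n :
  P (all_in n) = (iter n (branch_step pi F m) bweight 1%g)%:E.
Proof. by rewrite all_inE descend_prob. Qed.

End Descendants.
End TreeLaw.

(** * Law of the random walk *)

Section WalkLaw.
Context (R : realType).

Lemma integral_cells d (T : measurableType d) (P : probability T R) (J : choiceType)
    (s : seq J) (A : J -> set T) (C : set T) (f : T -> \bar R) :
  uniq s -> (forall y, measurable (A y)) -> trivIset [set` s] A ->
  measurable C -> (forall y, A y `<=` C) -> (P C = \sum_(y <- s) P (A y))%E ->
  measurable_fun setT f -> (forall w, 0 <= f w)%E ->
  (\int[P]_(w in C) f w = \sum_(y <- s) \int[P]_(w in A y) f w)%E.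
Proof.
move=> us mA tA mC AC PC mf f0.
have mfD D : measurable_fun D f by apply: measurable_funS mf.
set D := \big[setU/set0]_(y <- s) A y.
have DE : D = \bigcup_(y in [set` s]) A y by rewrite /D bigcup_seq.
have mD : measurable D by apply: bigsetU_measurable.
have DC : D `<=` C by rewrite DE => w [y _ /AC].
have PD : P D = P C.
  rewrite DE measure_fin_bigcup //.
  by rewrite PC [RHS]fsbig_seq.
have CD : P (C `\` D) = 0%E.
  have CID : C `&` D = D by apply/seteqP; split=> [w []|w Dw] //; split=> //; exact: DC.
  have PC0 : (P C - P D = 0)%E by rewrite PD subee // fin_num_measure.
  by rewrite measureD ?ltey_eq ?fin_num_measure // CID.
rewrite (ge0_negligible_integral (measurableD mC mD)) //.
have -> : C `\` (C `\` D) = D.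
  apply/seteqP; split=> w; last by move=> Dw; split; [exact: DC|case].
  by case=> Cw h; apply: contrapT => nD; apply: h.
by rewrite ge0_integral_bigsetU.
Qed.

Context (r : nat) (gT : 'I_r -> finGroupType).
Context d (T : measurableType d) (P : probability T R).
Context (m : freeprod gT -> R) (F : seq (freeprod gT)) (Y : nat -> T -> freeprod gT).
Hypotheses (uF : uniq F) (m_ge0 : forall y, 0 <= m y) (m_sum1 : \sum_(y <- F) m y = 1).
Hypothesis rwY : random_walk P m Y.
Local Notation G := (freeprod gT).

Definition path_event n (x : nat -> G) : set T :=
  [set w | forall k, (k <= n)%N -> Y k w = x k].

Definition path_weight n (x : nat -> G) : R :=
  (x 0%N == 1%g)%:R * \prod_(k < n) m ((x k)^-1 * x k.+1)%g.

Lemma path_prob n x : P (path_event n x) = (path_weight n x)%:E.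
Proof. exact: rwY.2. Qed.

Lemma measurable_walk_fun n (h : G -> R) : measurable_fun setT (fun w => (h (Y n w))%:E).
Proof.
move=> _ B mB; rewrite setTI.
rewrite (_ : _ @^-1` B = \bigcup_(y : G)
   (if `[< B (h y)%:E >] then [set w | Y n w = y] else set0)).
  apply: (countable_bigcupT_measurable (@freeprod_countable r gT)) => y.
  by case: ifP => // _; exact: rwY.1.
apply/seteqP; split=> w /= => [Bw|[y _]]; first by exists (Y n w) => //; rewrite asboolT.
by case: asboolP => // By /= ->.
Qed.

Lemma measurable_path_event n x : measurable (path_event n x).
Proof.
rewrite (_ : path_event n x = \bigcap_(k in [set k | (k <= n)%N]) [set w | Y k w = x k]).
  by apply: bigcap_measurable => [|k _]; [exists 0%N|exact: rwY.1].
by apply/seteqP; split=> w h k; exact: h.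
Qed.

(** The Markov property, by summation over the next position. *)
Lemma walk_integral j n x (h : G -> R) : (forall z, 0 <= h z) ->
  (\int[P]_(w in path_event n x) (h (Y (n + j) w))%:E =
   (path_weight n x * iter j (walk_step F m) h (x n))%:E)%E.
Proof.
move=> h0; elim: j n x => [|j ih] n x.
  rewrite addn0 (eq_integral (cst (h (x n))%:E)) => [|w]; last first.
    by rewrite inE => /(_ n (leqnn n)) ->.
  rewrite integral_cst; last exact: measurable_path_event.
  by rewrite mulrC EFinM -path_prob.
pose x' y k := if k == n.+1 then (x n * y)%g else x k.
have x'le y k : (k <= n)%N -> x' y k = x k by move=> kn; rewrite /x' ifN //; lia.
have wE y : path_weight n.+1 (x' y) = path_weight n x * m y.
  rewrite /path_weight big_ord_recr /= x'le // mulrA; congr (_ * _ * _).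
    by apply: eq_bigr => k _; rewrite !x'le // ltnW.
  by rewrite x'le // {1}/x' eqxx mulKg.
have sub y : path_event n.+1 (x' y) `<=` path_event n x.
  by move=> w hw k kn; rewrite hw ?x'le // ltnW.
rewrite (@integral_cells _ _ _ _ F (fun y => path_event n.+1 (x' y))) //; last 6 first.
- by move=> y; exact: measurable_path_event.
- move=> y y' _ _ [w [/(_ n.+1 (leqnn _)) + /(_ n.+1 (leqnn _))]].
  by rewrite /x' eqxx => -> /mulgI.
- exact: measurable_path_event.
- rewrite path_prob; under eq_bigr do rewrite path_prob wE.
  by rewrite sumEFin -mulr_sumr m_sum1 mulr1.
- exact: measurable_walk_fun.
- by move=> w; rewrite lee_fin.
rewrite -addSnnS; under eq_bigr do rewrite ih wE.
rewrite sumEFin; congr EFin; rewrite /= /walk_step mulr_sumr.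
by apply: eq_bigr => y _; rewrite /x' eqxx mulrA.
Qed.

Lemma walk_expectation n (h : G -> R) : (forall z, 0 <= h z) ->
  ('E_P[fun w => h (Y n w)] = (walk_mean F m n h)%:E)%E.
Proof.
move=> h0; rewrite unlock.
have := @walk_integral n 0 (fun=> 1%g) h h0.
rewrite /path_weight big_ord0 eqxx !mul1r add0n => <-.
rewrite (@integral_cells _ _ P _ [:: tt] (fun=> path_event 0 (fun=> 1%g))) //.
- by rewrite big_seq1.
- by move=> _; exact: measurable_path_event.
- by move=> [] [].
- by rewrite big_seq1 path_prob /path_weight big_ord0 eqxx mul1r probability_setT.
- exact: measurable_walk_fun.
- by move=> w; rewrite lee_fin.
Qed.

End WalkLaw.

(** * Almost sure bounds *)

Section BorelCantelli.
Context (R : realType) d (T : measurableType d) (P : probability T R).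

Lemma borel_cantelli_geometric (U : nat -> set T) (C q : R) :
  (forall n, measurable (U n)) -> 0 <= C -> 0 <= q < 1 ->
  (forall n, (P (U n) <= (C * q ^+ n)%:E)%E) ->
  {ae P, forall w, \forall n \near \oo, ~ U n w}.
Proof.
move=> mU C0 /andP[q0 q1] PU; have q1' : 0 < 1 - q by rewrite subr_gt0.
have sumP : (\sum_(0 <= n <oo) P (U n) < +oo)%E.
  apply: (@le_lt_trans _ _ (C / (1 - q))%:E); last exact: ltry.
  apply: lime_le; first by apply: is_cvg_nneseries.
  apply: nearW => M.
  apply: (@le_trans _ _ (\sum_(0 <= n < M) (C * q ^+ n)%:E)%E); first exact: lee_sum.
  rewrite sumEFin lee_fin -mulr_sumr ler_wpM2l // big_mkord.
  rewrite -[leRHS]mul1r ler_pdivlMr // mulrC.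
  have := subrX1 q M; have : 0 <= q ^+ M by exact: exprn_ge0.
  lra.
exists (lim_sup_set U); split.
- apply: bigcap_measurable => [|n _]; first by exists 0%N.
  by apply: bigcup_measurable.
- exact: lim_sup_set_cvg0.
move=> w; apply: contra_notP => nw; near_simpl.
have [n nU] : exists n, ~ exists2 j, (n <= j)%N & U j w.
  by apply/existsNP => h; apply: nw => n _; have [j nj Uj] := h n; exists j.
by exists n => // j /= nj Uj; apply: nU; exists j.
Qed.

(** By the inequality of Bernoulli, th <= q ^+ e for q = 1 - (1 - th) / e. *)
Lemma geometric_fraction (th : R) (e : nat) : 0 <= th < 1 -> (1 < e)%N ->
  exists C q, [/\ 0 <= C, 0 <= q < 1 & forall n, th ^+ (n %/ e) <= C * q ^+ n].
Proof.
move=> /andP[th0 th1] e1; have e0 : 0 < e%:R :> R by rewrite ltr0n ltnW.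
pose q : R := 1 - (1 - th) / e%:R.
have eq1 : (1 - q) * e%:R = 1 - th by rewrite /q; field; rewrite gt_eqF.
have q1 : q < 1 by rewrite -subr_gt0 -(pmulr_lgt0 _ e0) eq1 subr_gt0.
have q0 : 0 < q.
  have : (1 - q) * e%:R <= 1 by rewrite eq1; lra.
  have : 1 < e%:R :> R by rewrite ltr1n.
  have : 0 < 1 - q by lra.
  nra.
have thq : th <= q ^+ e.
  have q01 : 0 <= q <= 1 by rewrite !ltW.
  by have := bernoulli_le e q01; rewrite mulrC eq1; lra.
exists (q ^+ e)^-1, q; split; rewrite ?invr_ge0 ?exprn_ge0 ?(ltW q0) //.
move=> n; rewrite mulrC ler_pdivlMr ?exprn_gt0 //.
apply: (@le_trans _ _ (q ^+ (e * (n %/ e)) * q ^+ e)).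
  by rewrite ler_wpM2r ?exprn_ge0 ?(ltW q0) // exprM lerXn2r ?nnegrE ?exprn_ge0 // ltW.
rewrite -exprD ler_wiXn2l ?(ltW q0) ?(ltW q1) //.
by have := ltn_ceil n (ltnW e1); lia.
Qed.

End BorelCantelli.

Section StepLaw.
Context (R : realType) (r : nat) (gT : 'I_r -> finGroupType).
Context (alpha : 'I_r -> R) (mu : forall k, gT k -> R).
Hypotheses (alpha_ge0 : forall k, 0 <= alpha k) (alpha_sum : \sum_(k < r) alpha k = 1).
Hypothesis mu_prob : forall k, is_fin_prob (@mu k).
Local Notation G := (freeprod gT).

Definition one_letter : seq G :=
  undup [seq @fp_in r gT (tag t) (tagged t) | t <- enum {: {k : 'I_r & gT k}}].

Lemma mem_one_letter k (g : gT k) : fp_in g \in one_letter.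
Proof.
rewrite mem_undup; apply/mapP; exists (Tagged gT g) => //.
by rewrite mem_enum.
Qed.

Lemma mix_step_ge0 x : 0 <= mix_step alpha (@mu) x.
Proof.
apply: sumr_ge0 => k _; rewrite mulr_ge0 //; apply: sumr_ge0 => g _.
by case: (mu_prob k).
Qed.

Lemma mix_step_sum : \sum_(x <- one_letter) mix_step alpha (@mu) x = 1.
Proof.
rewrite /mix_step exchange_big -[RHS]alpha_sum /=; apply: eq_bigr => k _.
rewrite -mulr_sumr -[RHS]mulr1; congr (_ * _).
under eq_bigr do rewrite big_mkcond; rewrite exchange_big /=.
have [_ <-] := mu_prob k; apply: eq_bigr => g _.
rewrite (bigD1_seq (fp_in g)) ?mem_one_letter ?undup_uniq //= eqxx.
by rewrite big1 ?addr0 // => x; rewrite eq_sym => /negPf ->.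
Qed.

End StepLaw.

(** * The minimal speed *)

(** The number j of generations before the blocks of length n0 can be kept
    close to a prescribed number a. *)
Lemma split_generations (n a n0 : nat) : (0 < n0)%N -> (a <= n)%N ->
  exists j k, [/\ n = j + k * n0, a <= j & j <= a + n0]%N.
Proof.
move=> n00 an; exists (n - (n - a) %/ n0 * n0)%N, ((n - a) %/ n0)%N.
have := leq_trunc_div (n - a) n0; have := ltn_ceil (n - a) n00.
rewrite mulSn; move: (_ %/ _ * _)%N => b lt le; split; lia.
Qed.

Section Speed.
Context (R : realType) (r : nat) (gT : 'I_r -> finGroupType).
Context (S : forall k, {set gT k}).
Hypothesis genS : forall k, symmetric_generating S k.
Local Notation G := (freeprod gT).
Local Notation L := (wlen S).
Context (m : G -> R) (F : seq G).
Hypotheses (uF : uniq F) (m_ge0 : forall y, 0 <= m y) (m_sum1 : \sum_(y <- F) m y = 1).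
Context d' (Omega' : measurableType d') (P' : probability Omega' R).
Context (Y : nat -> Omega' -> G).
Hypothesis rwY : random_walk P' m Y.
Context (pi : nat -> R) (rho : R).
Hypothesis offpi : offspring_law pi rho.
Context d (Omega : measurableType d) (P : probability Omega R).
Context (N : vertex -> Omega -> nat) (zeta : vertex -> Omega -> G).
Hypothesis brw : branching_random_walk P pi m N zeta.

Local Notation vm := (v_min P' Y S rho).
Local Notation low := (lower_tail F m L).
Local Notation pos := (position zeta).

Let K := (\max_(y <- F) L y)%N.
Let L1 : L 1%g = 0%N. Proof. exact: wlen1. Qed.
Let LM (x y : G) : (L (x * y)%g <= L x + L y)%N. Proof. exact: wlenM. Qed.
Let LK (y : G) : y \in F -> (L y <= K)%N.
Proof. by move=> yF; apply: leq_bigmax_seq. Qed.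
Let rho1 : 1 < rho. Proof. by case: offpi. Qed.
Let rho0 : 0 < rho. Proof. exact: lt_trans rho1. Qed.
Let ln_rho0 : 0 < ln rho. Proof. exact: ln_gt0. Qed.
Let rhoE n : rho ^+ n = expR (n%:R * ln rho).
Proof. by rewrite expRM_natl lnK. Qed.

Lemma log_mgf_cgf t l : cgf_is F m L t l -> log_mgf P' Y S t = l.
Proof.
move=> cl; apply: cvg_lim => //; apply: cvg_trans cl.
rewrite (_ : mean_seq _ = (fun n => n%:R^-1 *
  ln (fine 'E_P'[fun w => expR (t * (wlen S (Y n w))%:R)]%E))) //.
apply/funext => n; rewrite (walk_expectation uF m_sum1 rwY n
  (h := fun z => expR (t * (L z)%:R))) // => z; exact: expR_ge0.
Qed.

Lemma rate_function_le x c :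
  (rate_function P' Y S x <= c%:E)%E <->
  forall t l, cgf_is F m L t l -> x * t - l <= c.
Proof.
split=> [le t l cl|le].
  rewrite -lee_fin; apply: le_trans le; rewrite -(log_mgf_cgf cl).
  by apply: ereal_sup_ubound; exists t.
apply: ge_ereal_sup => _ [t _ <-]; rewrite lee_fin.
have [l [cl _]] := cgf_ex m_ge0 m_sum1 L1 LM LK t.
by rewrite (log_mgf_cgf cl) le.
Qed.

Let A := [set x : R | 0 <= x /\ (rate_function P' Y S x <= (ln rho)%:E)%E].

(** The rate vanishes at the speed of the walk. *)
Let speedA : exists2 v, A v & forall t l, cgf_is F m L t l -> t * v <= l.
Proof.
have [v v0 vle] := speed_ex m_ge0 m_sum1 L1 LM LK.
exists v => //; split=> //; apply/rate_function_le => t l cl.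
by have := vle t l cl; have := ltW ln_rho0; lra.
Qed.

Let hasA : has_inf A.
Proof. by split; [have [v Av _] := speedA; exists v|exists 0 => x []]. Qed.

Lemma v_min_ge0 : 0 <= vm.
Proof. by apply: lb_le_inf; [case: hasA|move=> x []]. Qed.

Lemma v_min_above y : vm < y ->
  exists n, 1 < rho ^+ n * low n (n%:R * y).
Proof.
rewrite -subr_gt0 => /(inf_adherent (E := A)) /(_ hasA) [x [x0 Ix]].
rewrite addrC subrK => xy.
have [n _ ln] := lower_tail_dual m_ge0 m_sum1 L1 LM LK ln_rho0 x0 xy
  ((rate_function_le _ _).1 Ix).
exists n; rewrite rhoE mulrC -ltr_pdivrMr ?expR_gt0 //.
by rewrite div1r -expRN.
Qed.

(** Below the minimal speed the supremum that defines the rate is approached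
    at negative t only, since the speed is a subgradient at 0. *)
Lemma v_min_below x : 0 <= x -> x < vm ->
  exists t l, [/\ t <= 0, cgf_is F m L t l & ln rho < x * t - l].
Proof.
move=> x0 xv; have [v Av vle] := speedA.
have vmv : vm <= v by apply: ge_inf => //; case: hasA.
have nI : ~ (rate_function P' Y S x <= (ln rho)%:E)%E.
  move=> Ix; have : vm <= x by apply: ge_inf => //; case: hasA.
  by rewrite leNgt xv.
apply: contrapT => no; apply: nI; apply/rate_function_le => t l cl.
rewrite leNgt; apply/negP => lt; apply: no; exists t, l; split=> //.
rewrite leNgt; apply/negP => t0.
have := vle t l cl; have : 0 < t * (v - x) by rewrite mulr_gt0 // subr_gt0 (lt_le_trans xv).
have := ln_rho0; lra.
Qed.

Let beyond (c : R) (z : G) : bool := c < (L z)%:R.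

(** The first generations, about n / e of them, cost at most K each, which is
    negligible for large e; they make the probability that nobody stays close
    summable. *)
Lemma ae_some_close y : vm < y ->
  {ae P, forall w, \forall n \near \oo,
    exists v, [/\ gw_tree N w v, size v = n & (L (pos v w))%:R <= n%:R * y]}.
Proof.
move=> vy; pose y' := (vm + y) / 2.
have vy' : vm < y' by rewrite /y'; lra.
have y'0 : 0 <= y' by apply: le_trans (ltW vy'); exact: v_min_ge0.
have yy' : 0 < y - y' by rewrite /y'; lra.
have [n0 super] := v_min_above vy'.
have [th th01 bound] := branch_upper_bound offpi m_ge0 m_sum1 L1 LM LK super.
have n00 : (0 < n0)%N.
  case: n0 super {bound} => // ; rewrite mul1r.
  by rewrite ltNge lower_tail_le1.
pose e := (Num.trunc (2 * K%:R / (y - y'))).+2.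
have e0 : 0 < e%:R :> R by [].
have Ke : K%:R / e%:R <= (y - y') / 2.
  have Kp : 0 <= 2 * K%:R / (y - y') by rewrite divr_ge0 ?mulr_ge0 // ltW.
  have /andP[_ le] := truncn_itv Kp.
  have {}le : 2 * K%:R / (y - y') < e%:R.
    by apply: lt_le_trans le _; rewrite ler_nat.
  move: le; rewrite ltr_pdivrMr // ler_pdivrMr // => le.
  by rewrite mulrAC ler_pdivlMr //; lra.
have [//|C [q [C0 q01 Cq]]] := geometric_fraction th01 (e := e).
pose c n : R := ((n %/ e + n0) * K)%:R + n%:R * y'.
have := @borel_cantelli_geometric R d Omega P
  (fun n => all_in N zeta (beyond (c n)) n) C q _ C0 q01 _.
case=> [n|n|U [mU PU sub]].
- exact: (measurable_all_in brw).
- rewrite (all_in_prob offpi uF m_ge0 m_sum1 brw) lee_fin.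
  apply: le_trans (Cq n).
  have [j [k [nE je jle]]] := split_generations n00 (leq_div n e).
  rewrite {1}nE; apply: le_trans (bound k j (c n) _) _.
    rewrite /c lerD // ?ler_nat ?leq_mul //.
    rewrite mulrA -natrM; apply: ler_wpM2r => //.
    by rewrite ler_nat [leqRHS]nE leq_addl.
  by case/andP: th01 => ? ?; rewrite ler_wiXn2l // ltW.
exists U; split=> //; apply: subset_trans sub => w; apply: contra_not => near_w.
near=> n.
have /existsNP[v] : ~ all_in N zeta (beyond (c n)) n w by near: n.
move=> /not_implyP[tv] /not_implyP[sv] /negP; rewrite /beyond -leNgt => Lv.
exists v; split=> //; apply: le_trans Lv _.
have en : ((n %/ e)%:R * e%:R <= n%:R :> R) by rewrite -natrM ler_nat leq_trunc_div.
have nK : 2 * (n0%:R * K%:R) / (y - y') <= n%:R by near: n; exact: nbhs_infty_ger.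
move: nK; rewrite ler_pdivrMr // => nK.
rewrite /c natrM natrD.
have : (n %/ e)%:R * K%:R <= n%:R * ((y - y') / 2).
  apply: (@le_trans _ _ (n%:R * (K%:R / e%:R))); last by rewrite ler_wpM2l.
  by rewrite mulrCA mulrC ler_wpM2l // ler_pdivlMr.
lra.
Unshelve. all: by end_near.
Qed.

(** Union bound and exponential Markov inequality. *)
Lemma ae_all_far x : 0 <= x -> x < vm ->
  {ae P, forall w, \forall n \near \oo,
    forall v, gw_tree N w v -> size v = n -> n%:R * x < (L (pos v w))%:R}.
Proof.
move=> x0 xv; have [t [l [t0 cl tl]]] := v_min_below x0 xv.
have [l' [cl' lle]] := cgf_ex m_ge0 m_sum1 L1 LM LK t.
have {cl' lle} lle n : ln (mgf F m L n t) <= n%:R * l.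
  by rewrite -(log_mgf_cgf cl) (log_mgf_cgf cl'); exact: lle.
pose q := expR (ln rho - (x * t - l)).
have q01 : 0 <= q < 1 by rewrite expR_ge0 /q expR_lt1 subr_lt0.
have := @borel_cantelli_geometric R d Omega P
  (fun n => ~` all_in N zeta (beyond (n%:R * x)) n) 1 q _ ler01 q01 _.
case=> [n|n|U [mU PU sub]].
- by apply: measurableC; exact: (measurable_all_in brw).
- rewrite probability_setC; last exact: (measurable_all_in brw).
  rewrite (all_in_prob offpi uF m_ge0 m_sum1 brw) -EFinB lee_fin mul1r.
  apply: le_trans (branch_first_moment offpi m_ge0 m_sum1 L n (n%:R * x)) _.
  apply: (@le_trans _ _ (rho ^+ n * (expR (- (t * (n%:R * x))) * mgf F m L n t))).
    by rewrite ler_wpM2l ?exprn_ge0 ?(ltW rho0) // lower_tail_chernoff.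
  have mgf0 : 0 < mgf F m L n t by exact: (mgf_gt0 m_ge0 m_sum1 L1 LM LK).
  rewrite -[mgf _ _ _ _ _]lnK ?posrE // rhoE -!expRD /q -expRM_natl ler_expR.
  have := lle n; lra.
exists U; split=> //; apply: subset_trans sub => w; apply: contra_not.
apply: filterS => n /contrapT all_far v tv sv; exact: all_far v tv sv.
Qed.

(** Both bounds hold for all margins 1 / (i + 1) outside one negligible set.
    The bound from above also provides a particle in each late generation, so
    that the minimum there is attained. *)
Lemma min_position_cvg :
  {ae P, forall w,
    (fun n : nat => (min_position N zeta S n w)%:R / n%:R : R) @ \oo --> vm}.
Proof.
pose eps (i : nat) : R := i.+1%:R^-1.
have eps0 i : 0 < eps i by rewrite invr_gt0.
have up : {ae P, forall w, forall i, \forall n \near \oo,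
    exists v, [/\ gw_tree N w v, size v = n & (L (pos v w))%:R <= n%:R * (vm + eps i)]}.
  by apply: ae_foralln => i; apply: ae_some_close; rewrite ltrDl.
have lo : {ae P, forall w, forall i, \forall n \near \oo,
    forall v, gw_tree N w v -> size v = n -> n%:R * (vm - eps i) <= (L (pos v w))%:R}.
  apply: ae_foralln => i; have [x0|x0] := leP 0 (vm - eps i); last first.
    apply: aeW => w; apply: nearW => n v _ _.
    by apply: le_trans (ler0n _ _); rewrite mulr_ge0_le0 // ltW.
  have : vm - eps i < vm by rewrite gtrBl.
  move=> /(ae_all_far x0); apply: filterS => w; apply: filterS => n h v tv sv.
  exact: ltW (h v tv sv).
apply: filterS2 up lo => w up lo; apply/cvgrPdist_le => e e_gt0.
have [i ie] : exists i, eps i <= e.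
  have [i /ltW ie] : exists i : nat, e^-1 < i%:R.
    have eV0 : 0 <= e^-1 by rewrite invr_ge0 ltW.
    by exists (Num.trunc e^-1).+1; have /andP[] := truncn_itv eV0.
  exists i; rewrite /eps invf_ple ?posrE //; apply: le_trans ie _.
  by rewrite ler_nat.
near=> n.
have n0 : 0 < n%:R :> R by rewrite ltr0n; near: n; exists 1%N.
have [v [tv sv Lv]] : exists v, [/\ gw_tree N w v, size v = n &
  (L (pos v w))%:R <= n%:R * (vm + eps i)] by near: n; exact: up.
have lon : forall v, gw_tree N w v -> size v = n ->
  n%:R * (vm - eps i) <= (L (pos v w))%:R by near: n; exact: lo.
rewrite distrC; apply: le_trans ie.
pose B := [set L (pos v w) | v in [set v | gw_tree N w v /\ size v = n]].
have [|[u [tu su] uE] minP] := @nat_minP B; first by exists (L (pos v w)), v.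
rewrite /min_position -/B -uE ler_norml; apply/andP; split.
  by rewrite lerBrDl ler_pdivlMr // mulrC lon.
rewrite lerBlDl ler_pdivrMr // mulrC; apply: le_trans Lv.
by rewrite ler_nat uE; apply: minP; exists v.
Unshelve. all: by end_near.
Qed.

End Speed.

Theorem theorem2 (R : realType)
  (r : nat) (gT : 'I_r -> finGroupType) (S : forall k, {set gT k})
  (alpha : 'I_r -> R) (mu : forall k, gT k -> R)
  (d' : measure_display) (Omega' : measurableType d')
  (P' : probability Omega' R) (Y : nat -> Omega' -> freeprod gT)
  (pi : nat -> R) (rho : R)
  (d : measure_display) (Omega : measurableType d)
  (P : probability Omega R)
  (N : vertex -> Omega -> nat) (zeta : vertex -> Omega -> freeprod gT) :
  (2 <= r)%N ->
  (forall k, (1 < #|gT k|)%N) ->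
  (forall k, symmetric_generating S k) ->
  (forall k, 0 < alpha k) ->
  \sum_(k < r) alpha k = 1 ->
  (forall k, is_fin_prob (mu k)) ->
  (forall k, irreducible_step (mu k)) ->
  (r = 2%N -> exists k, (2 < #|gT k|)%N) ->
  random_walk P' (mix_step alpha mu) Y ->
  offspring_law pi rho ->
  branching_random_walk P pi (mix_step alpha mu) N zeta ->
  {ae P, forall w,
    (fun n : nat => (min_position N zeta S n w)%:R / n%:R : R) @ \oo -->
    v_min P' Y S rho}.
Proof.
move=> _ _ genS alpha_gt0 alpha_sum muP _ _ rwY offpi brw.
have m_ge0 := mix_step_ge0 (fun k => ltW (alpha_gt0 k)) muP.
have m_sum1 := mix_step_sum alpha_sum muP.
exact: (min_position_cvg genS (undup_uniq _) m_ge0 m_sum1 rwY offpi brw).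
Qed.
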